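(* Let $K$ be a $\sigma$-Stonean compact Hausdorff space, i.e. a compact Hausdorff space in which the closure of any open $F_\sigma$ set is open. Then $C(K)$ is $1$-Grothendieck. In particular, $C(K)$ is $1$-Grothendieck whenever $K$ is an extremally disconnected compact Hausdorff space (i.e. a compact Hausdorff space in which every open set has open closure). (Here $C(K)$ denotes either $C(K;\mathbb{R})$ or $C(K;\mathbb{C})$; the assertion holds for both.)
   Context: $C(K;\mathbb{R})$ and $C(K;\mathbb{C})$ denote the Banach spaces of continuous real-valued (respectively complex-valued) functions on $K$ with the supremum norm. For a Banach space $X$ (real or complex), $B_X$ denotes its closed unit ball, $X^{\ast}$ its dual and $X^{\ast\ast}$ its bidual. For a sequence $(a_n)$ of scalars, $\mathrm{clust}(a_n)$ is the set of all its cluster points. For a bounded sequence $(x_n^{\ast})_{n\in\mathbb{N}}$ in $X^{\ast}$ put $$\delta_{w^{\ast}}(x_n^{\ast}):=\sup\{\mathrm{diam}\,\mathrm{clust}(x_n^{\ast}(x)) : x\in B_X\},\qquad \delta_{w}(x_n^{\ast}):=\sup\{\mathrm{diam}\,\mathrm{clust}(x^{\ast\ast}(x_n^{\ast})) : x^{\ast\ast}\in B_{X^{\ast\ast}}\}.$$ For $c\geq 1$, $X$ is called $c$-Grothendieck if $\delta_w(x_n^{\ast})\leq c\,\delta_{w^{\ast}}(x_n^{\ast})$ for every bounded sequence $(x_n^{\ast})_{n\in\mathbb{N}}$ in $X^{\ast}$. *)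

(* Defs.v *)
From HB Require Import structures.
From mathcomp Require Import all_boot all_order all_algebra.
From mathcomp Require Import ring.
From mathcomp Require Import all_classical all_reals all_analysis.
From mathcomp Require Import borel_hierarchy complex.

Set Implicit Arguments.
Unset Strict Implicit.
Unset Printing Implicit Defensive.

Import Order.TTheory GRing.Theory Num.Theory.
Import numFieldNormedType.Exports.

Local Open Scope classical_set_scope.
Local Open Scope ring_scope.

(* In a numFieldType F the norm takes its values in F itself, so norms, diameters
   and suprema below are (nonnegative real) elements of F, compared by the order
   of F; for F = R[i], x <= y means that Im x = Im y and Re x <= Re y, which on
   the real axis is the order of R. A set of nonnegative elements of R[i] that is
   bounded above thus has as its supremum the real supremum. Existence of such
   suprema, with completeness, is all that is required of scalars below; the
   instances of interest are R and R[i]. *)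
HB.mixin Record NumField_isScalarField F & Num.NumField F := {
  nneg_has_sup : forall A : set F, A !=set0 -> has_ubound A ->
    (forall x, A x -> 0 <= x) -> supremums A !=set0 ;
  scalar_cauchy_cvg : forall G : set_system F^o, ProperFilter G -> cauchy G -> cvg G
}.

#[short(type="scalarFieldType")]
HB.structure Definition ScalarField := {F of Num.NumField F & NumField_isScalarField F}.

Section scalar_instances.
Variable R : realType.

Lemma real_nneg_has_sup (A : set R) : A !=set0 -> has_ubound A ->
  (forall x, A x -> 0 <= x) -> supremums A !=set0.
Proof.
move=> A0 ubA _; exists (sup A); split; first exact/ubP/(@sup_upper_bound _ A).
by move=> y ubAy; apply: ge_sup.
Qed.

HB.instance Definition _ := NumField_isScalarField.Build R
  real_nneg_has_sup (@R_complete R).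

Lemma complex_nneg_has_sup (A : set R[i]) : A !=set0 -> has_ubound A ->
  (forall x, A x -> 0 <= x) -> supremums A !=set0.
Proof.
move=> [a Aa] [b ubAb] A_ge0.
have ImA x : A x -> complex.Im x = 0.
  by move=> /A_ge0; rewrite lecE => /andP[/eqP -> _].
have ub_Im y : ubound A y -> complex.Im y = 0.
  by move=> /(_ a Aa); rewrite lecE => /andP[/eqP -> _]; exact: ImA.
pose B := [set complex.Re x | x in A].
have supB : has_sup B.
  split; first by exists (complex.Re a), a.
  by exists (complex.Re b) => _ [x Ax <-]; have := ubAb x Ax; rewrite lecE => /andP[].
exists (Complex (sup B) 0); split=> [x Ax|y ubAy]; rewrite lecE /=.
  by rewrite ImA// eqxx/=; apply: ub_le_sup; [exact: supB.2 | exists x].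
rewrite ub_Im// eqxx/=; apply: ge_sup; first exact: supB.1.
by move=> _ [x Ax <-]; have := ubAy x Ax; rewrite lecE => /andP[].
Qed.

Lemma normc_le_ReIm (z : R[i]) :
  `|z| <= (`|complex.Re z| + `|complex.Im z|)%:C%C.
Proof.
rewrite [z in leLHS]complexE (le_trans (ler_normD _ _))// rmorphD/= lerD//.
  by rewrite normc_def/= expr0n addr0 sqrtr_sqr.
by rewrite normrM !normc_def/= !expr0n/= expr1n addr0 add0r sqrtr1 mul1r sqrtr_sqr.
Qed.

Lemma normc_ge_Im (z : R[i]) : `|complex.Im z|%:C%C <= `|z|.
Proof. by rewrite normc_def lecR -sqrtr_sqr ler_wsqrtr// lerDr sqr_ge0. Qed.

Lemma complex_cauchy_cvg (G : set_system R[i]^o) :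
  ProperFilter G -> cauchy G -> cvg G.
Proof.
move=> GG /cauchyP cG.
have part_cvg (p : R[i] -> R) : (forall z w, p (z - w) = p z - p w) ->
    (forall z, `|p z|%:C%C <= `|z|) -> cvg (p @ G).
  move=> pB p_le; apply: R_complete; apply/cauchy_exP => e e0.
  have [|z Gz] := cG e%:C%C; first by rewrite ltcR.
  exists (p z); change (G (p @^-1` ball (p z) e)); apply: filterS Gz => w; rewrite -!ball_normE/= => zw.
  by rewrite -pB -ltcR (le_lt_trans (p_le _)).
have ReB (z w : R[i]) : complex.Re (z - w) = complex.Re z - complex.Re w.
  by case: z w => [? ?] [].
have ImB (z w : R[i]) : complex.Im (z - w) = complex.Im z - complex.Im w.
  by case: z w => [? ?] [].
have /cvg_ex[a Ga] := part_cvg _ ReB (@normc_ge_Re R).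
have /cvg_ex[b Gb] := part_cvg _ ImB normc_ge_Im.
apply/cvg_ex; exists (Complex a b); apply/cvgrPdist_lt => e.
rewrite ltcE/= => /andP[/eqP Ime e0].
have {Ime} -> : e = (complex.Re e)%:C%C by case: e Ime e0 => x y /= ->.
have e2 : 0 < complex.Re e / 2 by rewrite divr_gt0.
move/cvgrPdist_lt/(_ _ e2) : Ga => Ga; move/cvgrPdist_lt/(_ _ e2) : Gb => Gb.
apply: filterS2 Ga Gb => z az bz; rewrite (le_lt_trans (normc_le_ReIm _))// ltcR.
by rewrite ReB ImB/= [ltRHS]splitr ltrD.
Qed.

HB.instance Definition _ := NumField_isScalarField.Build R[i]
  complex_nneg_has_sup complex_cauchy_cvg.

End scalar_instances.

Section supremum_nneg.
Variables (F : scalarFieldType) (I : Type) (D : set I) (h : I -> F).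
Hypothesis h_ge0 : forall i, D i -> 0 <= h i.

Let A := [set h i | i in D].

Lemma nneg_supremums (M : F) : A !=set0 -> (forall i, D i -> h i <= M) ->
  supremums A (supremum 0 A).
Proof.
move=> A0 hM; rewrite /supremum; case: ifPn => [/eqP AE|_].
  by case: A0 => x; rewrite AE.
have [s sP] : supremums A !=set0.
  apply: nneg_has_sup => //; first by exists M => _ [i Di <-]; exact: hM.
  by move=> _ [i Di <-]; exact: h_ge0.
exact: (xgetPex _ (ex_intro _ s sP)).
Qed.

Lemma le_supremum_nneg (M : F) i : (forall i, D i -> h i <= M) -> D i ->
  h i <= supremum 0 A.
Proof.
move=> hM Di; have [//|ub _] := @nneg_supremums M _ hM; first by exists (h i), i.
by apply: ub; exists i.
Qed.

Lemma supremum_nneg_le (M : F) : 0 <= M -> (forall i, D i -> h i <= M) ->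
  supremum 0 A <= M.
Proof.
move=> M0 hM; have [->|/set0P A0] := eqVneq A set0; first by rewrite supremum0.
have [_ lb] := nneg_supremums A0 hM.
by apply: lb => _ [i Di <-]; exact: hM.
Qed.

Lemma supremum_nneg_ge0 (M : F) : (forall i, D i -> h i <= M) ->
  0 <= supremum 0 A.
Proof.
move=> hM; have [->|/set0P[_ [i Di _]]] := eqVneq A set0; first by rewrite supremum0.
exact: le_trans (h_ge0 Di) (le_supremum_nneg hM Di).
Qed.

End supremum_nneg.

Definition unit_ball (F : numFieldType) (X : normedModType F) : set X :=
  [set x | `|x| <= 1].

Section dual.
Variables (F : scalarFieldType) (X : normedModType F).

Definition dual_pred : {pred X -> F^o} :=
  mem [set f : X -> F^o | linear f /\ continuous f].

Record dual := Dual {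
  dual_fun :> X -> F^o ;
  dualP : dual_fun \in dual_pred
}.

HB.instance Definition _ := [isSub for dual_fun].
HB.instance Definition _ := [Choice of dual by <:].

Lemma dual_pred_submod_closed : submod_closed dual_pred.
Proof.
split=> [|a f g].
  by rewrite inE; split=> [a x y|]; [rewrite /= scaler0 addr0|exact: cst_continuous].
rewrite !inE => -[lf cf] [lg cg]; split=> [k x y|x].
  rewrite /= !fctE lf lg !scalerDr !scalerA (mulrC a) -!addrA; congr (_ + _).
  by rewrite addrCA.
by apply: cvgD; [apply: cvgZr; exact: cf|exact: cg].
Qed.

HB.instance Definition _ :=
  GRing.isSubmodClosed.Build _ _ dual_pred dual_pred_submod_closed.
HB.instance Definition _ := [SubChoice_isSubLmodule of dual by <:].

Implicit Types f g : dual.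

Lemma dual_linear f : linear f.
Proof. by have := dualP f; rewrite inE => -[]. Qed.

HB.instance Definition _ f :=
  GRing.isLinear.Build F X F^o *:%R (f : X -> F^o) (dual_linear f).

Lemma dual_continuous f : continuous f.
Proof. by have := dualP f; rewrite inE => -[]. Qed.

Definition dual_norm f : F := supremum 0 [set `|f x| | x in @unit_ball F X].

Lemma dual_bounded f : exists M : F, forall x, unit_ball x -> `|f x| <= M.
Proof.
have /continuous_linear_bounded/linear_boundedP fM : {for 0, continuous f}.
  exact: dual_continuous.
have [M M0 Mf] := pinfty_ex_gt0 fM.
by exists M => x x1; rewrite (le_trans (Mf x))// ler_piMr// ltW.
Qed.

Lemma dual_norm_ub f x : unit_ball x -> `|f x| <= dual_norm f.
Proof.
have [M fM] := dual_bounded f.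
exact: (@le_supremum_nneg F X _ (fun x => `|f x|) _ M).
Qed.

Lemma dual_norm_le f (M : F) : 0 <= M -> (forall x, unit_ball x -> `|f x| <= M) ->
  dual_norm f <= M.
Proof. by move=> M0 fM; apply: supremum_nneg_le. Qed.

Lemma dual_norm_ge0 f : 0 <= dual_norm f.
Proof.
have [M fM] := dual_bounded f.
exact: (@supremum_nneg_ge0 F X _ (fun x => `|f x|) _ M).
Qed.

Lemma dual_normD f g : dual_norm (f + g) <= dual_norm f + dual_norm g.
Proof.
apply: dual_norm_le => [|x x1]; first by rewrite addr_ge0 ?dual_norm_ge0.
by rewrite (le_trans (ler_normD _ _))// lerD// dual_norm_ub.
Qed.

Lemma dual_normZ (a : F) f : dual_norm (a *: f) = `|a| * dual_norm f.
Proof.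
have normZ_le b g : dual_norm (b *: g) <= `|b| * dual_norm g.
  apply: dual_norm_le => [|x x1]; first by rewrite mulr_ge0 ?dual_norm_ge0.
  by rewrite [leLHS]normrM ler_wpM2l// dual_norm_ub.
apply/eqP; rewrite eq_le normZ_le/=.
have [->|a0] := eqVneq a 0; first by rewrite normr0 mul0r dual_norm_ge0.
rewrite -ler_pdivlMl ?normr_gt0// -normfV (le_trans _ (normZ_le _ _))//.
by rewrite scalerA mulVf// scale1r.
Qed.

Lemma dual_norm_eq0 f : dual_norm f = 0 -> f = 0.
Proof.
move=> f0; apply/val_inj/funext => x /=.
have [->|x0] := eqVneq x 0; first by rewrite (linear0 f).
have x1 : unit_ball (`|x|^-1 *: x).
  by rewrite /unit_ball/= normrZ normfV normr_id mulVf// normr_eq0.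
have := dual_norm_ub f x1; rewrite f0 normr_le0 linearZ/= => /eqP.
by move/eqP; rewrite scaler_eq0 invr_eq0 normr_eq0 (negPf x0)/= => /eqP.
Qed.

HB.instance Definition _ := Lmodule_isNormed.Build F dual
  dual_normD dual_normZ dual_norm_eq0.

End dual.

Section grothendieck.
Variable F : scalarFieldType.

Definition diam (A : set F) : F := supremum 0 [set `|p.1 - p.2| | p in A `*` A].

Definition clust (a : nat -> F) : set F := cluster ((a : nat -> F^o) @ \oo).

Variable X : completeNormedModType F.
Implicit Type u : nat -> dual X.

Definition delta_weak_star u : F :=
  supremum 0 [set diam (clust (fun n => u n x)) | x in @unit_ball F X].

Definition delta_weak u : F :=
  supremum 0 [set diam (clust (fun n => phi (u n)))
             | phi in @unit_ball F (dual (dual X))].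

Definition grothendieck (c : F) :=
  forall u, bounded_fun u -> delta_weak u <= c * delta_weak_star u.

End grothendieck.
Arguments grothendieck {F} X c.

HB.mixin Record Topological_isCompactHausdorff K & Topological K := {
  compact_setT : compact [set: K] ;
  hausdorff_setT : hausdorff_space K
}.

#[short(type="compactHausdorffType")]
HB.structure Definition CompactHausdorff :=
  {K of Topological K & Topological_isCompactHausdorff K}.

Definition sigma_stonean (K : topologicalType) :=
  forall U : set K, open U -> Fsigma U -> open (closure U).

Definition extremally_disconnected (K : topologicalType) :=
  forall U : set K, open U -> open (closure U).

Section continuous_functions.
Variables (K : compactHausdorffType) (F : scalarFieldType).

Definition cfun_pred : {pred K -> F^o} := mem [set f : K -> F^o | continuous f].

Record cfun := CFun {
  cfun_fun :> K -> F^o ;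
  cfunP : cfun_fun \in cfun_pred
}.

HB.instance Definition _ := [isSub for cfun_fun].
HB.instance Definition _ := [Choice of cfun by <:].

Lemma cfun_pred_submod_closed : submod_closed cfun_pred.
Proof.
split=> [|a f g]; first by rewrite inE; exact: cst_continuous.
rewrite !inE => cf cg x.
by apply: cvgD; [apply: cvgZr; exact: cf|exact: cg].
Qed.

HB.instance Definition _ :=
  GRing.isSubmodClosed.Build _ _ cfun_pred cfun_pred_submod_closed.
HB.instance Definition _ := [SubChoice_isSubLmodule of cfun by <:].

Implicit Types f g : cfun.

Lemma cfun_continuous f : continuous f.
Proof. by have := cfunP f; rewrite inE. Qed.

Definition cfun_norm f : F := supremum 0 [set `|f t| | t in [set: K]].

Lemma cfun_bounded f : exists M : F, forall t, `|f t| <= M.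
Proof.
have /compact_near_coveringP KP := @compact_setT K.
suff /pinfty_ex_gt0[M _ fM] : \forall M \near +oo, [set: K] `<=` (fun t => `|f t| <= M).
  by exists M => t; exact: fM.
apply: KP => t _.
have ft : \forall t' \near t, `|f t'| <= `|f t| + 1.
  have /cvgrPdist_le/(_ 1 ltr01) := @cfun_continuous f t.
  apply: filterS => t' ftt'.
  by rewrite -lerBlDl (le_trans (lerB_dist _ _))// distrC.
exists ([set t' | `|f t'| <= `|f t| + 1], [set M : F | `|f t| + 1 <= M]).
  split => //=; apply: nbhs_pinfty_ge.
  by rewrite ger0_real// addr_ge0.
by move=> [t' M]/= [] /le_trans; exact.
Qed.

Lemma cfun_norm_ub f t : `|f t| <= cfun_norm f.
Proof.
have [M fM] := cfun_bounded f.
exact: (@le_supremum_nneg F K setT (fun t => `|f t|) _ M).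
Qed.

Lemma cfun_norm_le f (M : F) : 0 <= M -> (forall t, `|f t| <= M) ->
  cfun_norm f <= M.
Proof. by move=> M0 fM; apply: supremum_nneg_le. Qed.

Lemma cfun_norm_ge0 f : 0 <= cfun_norm f.
Proof.
have [M fM] := cfun_bounded f.
exact: (@supremum_nneg_ge0 F K setT (fun t => `|f t|) _ M).
Qed.

Lemma cfun_normD f g : cfun_norm (f + g) <= cfun_norm f + cfun_norm g.
Proof.
apply: cfun_norm_le => [|t]; first by rewrite addr_ge0 ?cfun_norm_ge0.
by rewrite (le_trans (ler_normD _ _))// lerD// cfun_norm_ub.
Qed.

Lemma cfun_normZ (a : F) f : cfun_norm (a *: f) = `|a| * cfun_norm f.
Proof.
have normZ_le b g : cfun_norm (b *: g) <= `|b| * cfun_norm g.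
  apply: cfun_norm_le => [|t]; first by rewrite mulr_ge0 ?cfun_norm_ge0.
  by rewrite [leLHS]normrM ler_wpM2l// cfun_norm_ub.
apply/eqP; rewrite eq_le normZ_le/=.
have [->|a0] := eqVneq a 0; first by rewrite normr0 mul0r cfun_norm_ge0.
rewrite -ler_pdivlMl ?normr_gt0// -normfV (le_trans _ (normZ_le _ _))//.
by rewrite scalerA mulVf// scale1r.
Qed.

Lemma cfun_norm_eq0 f : cfun_norm f = 0 -> f = 0.
Proof.
move=> f0; apply/val_inj/funext => t /=.
by have := cfun_norm_ub f t; rewrite f0 normr_le0 => /eqP.
Qed.

HB.instance Definition _ := Lmodule_isNormed.Build F cfun
  cfun_normD cfun_normZ cfun_norm_eq0.

Lemma cfun_cauchy_cvg (G : set_system cfun) : ProperFilter G -> cauchy G -> cvg G.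
Proof.
move=> GG /cauchyP cG.
have eval_cvg t : cvg ((fun f : cfun => f t) @ G).
  apply: scalar_cauchy_cvg; apply/cauchy_exP => e e0.
  have [f Gf] := cG e e0; exists (f t).
  change (G ((fun g : cfun => g t) @^-1` ball (f t) e)); apply: filterS Gf => g.
  rewrite -!ball_normE/=; apply: le_lt_trans.
  exact: (cfun_norm_ub (f - g) t).
pose l t : F^o := lim ((fun f : cfun => f t) @ G).
have Gl (e : F) : 0 < e ->
      \forall f \near G, forall t, `|l t - (f : cfun) t| <= e.
  move=> e0; have e2 : 0 < e / 2 by rewrite divr_gt0.
  have [f0 Gf0] := cG _ e2.
  have f0_near g t : ball f0 (e / 2) g -> `|f0 t - g t| < e / 2.
    rewrite -ball_normE/=; apply: le_lt_trans; exact: (cfun_norm_ub (f0 - g) t).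
  have f0l t : `|l t - f0 t| <= e / 2.
    apply/ler_addgt0Pr => d d0.
    have /cvgrPdist_lt/(_ _ d0) Gt := eval_cvg t.
    near G => g.
    have gf0 : `|f0 t - g t| < e / 2.
      by apply: f0_near; near: g; exact: Gf0.
    have gl : `|l t - g t| < d by near: g; exact: Gt.
    rewrite (le_trans (ler_distD (g t) _ _))// addrC lerD//; last exact: ltW.
    by rewrite distrC ltW.
  apply: filterS Gf0 => g /f0_near gf0 t.
  rewrite (le_trans (ler_distD (f0 t) _ _))// [leRHS]splitr lerD//.
  by rewrite ltW.
have cl : continuous l.
  move=> t; apply/cvgrPdist_le => e e0.
  have e3 : 0 < e / 3 by rewrite divr_gt0.
  have [f lf] := filter_ex (Gl _ e3).
  have /cvgrPdist_le/(_ _ e3) := @cfun_continuous f t.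
  apply: filterS => t' ftt'.
  rewrite (le_trans (ler_distD (f t) _ _))//.
  have -> : e = e / 3 + (e / 3 + e / 3) by field.
  rewrite lerD// (le_trans (ler_distD (f t') _ _))// lerD// distrC.
  exact: lf.
apply/cvg_ex; exists (CFun (mem_set cl : l \in cfun_pred)).
apply/cvgrPdist_le => e e0; apply: filterS (Gl e e0) => f lf.
by apply: cfun_norm_le => [|t]; [exact: ltW|exact: lf].
Unshelve. all: by end_near. Qed.

HB.instance Definition _ := Uniform_isComplete.Build cfun cfun_cauchy_cvg.

End continuous_functions.

(* Main.v *)
Require Import Defs.
From HB Require Import structures.
From mathcomp Require Import all_boot all_order all_algebra.
From mathcomp Require Import ring lra.
From mathcomp Require Import all_classical all_reals all_analysis.
From mathcomp Require Import complex.

Set Implicit Arguments.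
Unset Strict Implicit.
Unset Printing Implicit Defensive.

Import Order.TTheory GRing.Theory Num.Theory.
Import numFieldNormedType.Exports.

Local Open Scope classical_set_scope.
Local Open Scope ring_scope.

(** Functionals on C(K) are handled as finitely additive measures, through their
    total variation on nonnegative continuous functions.

    Let phi be in the unit ball of the bidual, and p, q cluster points of
    phi (nu n). Along two subsequences, suitably rotated differences u k of the
    functionals satisfy lim Re phi (u k) = |p - q|. It suffices to find one x in
    the unit ball of C(K) such that Re (u k x) is nearly |p - q| for infinitely
    many k ([coherent_witness]): further subsequences of nu n x then have limits
    at that distance ([oscillation_witness]).

    Goldstine's theorem gives, for every n, a function in the unit ball that is
    good for u 0, ..., u (n - 1). For each n these functions form a convex set
    A n ([witnesses]), and A n decreases with n. Let rho be a limit, along an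
    ultrafilter, of the variations of the u k. In the seminorm of L2(rho),
    near-minimisers z i in A n, with n large, form a Cauchy sequence
    ([near_minimizers]). So z i and z (i + 1) differ noticeably only on a clopen
    set D i on which rho is small; then almost all u k are small on D i too.
    Hence one can choose indices k i so that z i is good for u (k i) while
    u (k i) is small on D j for all j < i - 1 ([gliding_hump]).

    In particular u (k i) can distinguish z i from the initial z 0 only on the
    part of D (i - 1) outside the earlier D j, and these parts are pairwise
    disjoint clopen sets. As K is sigma-Stonean, there is a continuous x equal
    to z i on the i-th part and to z 0 away from the closure of their union
    ([patch]). The mass that u (k i) could have on the closure of the union of
    the other parts is removed by passing to a subfamily of the parts, by
    Rosenthal's lemma ([rosenthal_disjoint]); then u (k i) has nearly the same
    value at x as at z i. *)

(** * Scalars with a real part *)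

(** The facts about the scalars R and R[i] that the argument uses, so that both
    cases are proved at once. Real numbers embed by [ofR], and the norm, whose
    values lie in F, is read as a real number through [re]. The parallelogram
    identity for scalars turns the positive functional built below into a
    Hilbert seminorm; compactness of balls gives finite nets of scalars and limits
    along ultrafilters. *)
Record real_structure (R : realType) (F : scalarFieldType) := RealStructure {
  ofR : {rmorphism R -> F} ;
  re : F -> R ;
  ler_ofR : forall a b, (ofR a <= ofR b) = (a <= b) ;
  reK : forall x, 0 <= x -> ofR (re x) = x ;
  reD : forall x y, re (x + y) = re x + re y ;
  reZ : forall a x, re (ofR a * x) = a * re x ;
  re1 : re 1 = 1 ;
  re_le_norm : forall x, ofR (re x) <= `|x| ;
  norm_parallelogram : forall x y : F,
    `|x + y| ^+ 2 + `|x - y| ^+ 2 = (`|x| ^+ 2 + `|y| ^+ 2) *+ 2 ;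
  compact_closed_ball0 : forall r : F, compact [set x : F^o | `|x| <= r]
}.

Section real_structure_theory.
Variables (R : realType) (F : scalarFieldType) (s : real_structure R F).
Local Notation io := (ofR s).
Local Notation re := (re s).
Implicit Types (a b : R) (x y : F).

Definition nrm x : R := re `|x|.

Lemma nrmE x : io (nrm x) = `|x|.
Proof. by rewrite reK. Qed.

Lemma ltr_ofR a b : (io a < io b) = (a < b).
Proof. by rewrite !lt_neqAle ler_ofR (inj_eq (fmorph_inj _)). Qed.

Lemma re_ofR a : re (io a) = a.
Proof. by rewrite -[io a]mulr1 reZ re1 mulr1. Qed.

Lemma ofR_ge0 a : (0 <= io a) = (0 <= a).
Proof. by rewrite -[0](rmorph0 io) ler_ofR. Qed.

Lemma ofR_gt0 a : (0 < io a) = (0 < a).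
Proof. by rewrite -[0](rmorph0 io) ltr_ofR. Qed.

Lemma norm_ofR a : `|io a| = io `|a|.
Proof.
have [a0|a0] := leP 0 a; first by rewrite !ger0_norm ?ofR_ge0.
by rewrite (ltr0_norm a0) -normrN -rmorphN ger0_norm// ofR_ge0 oppr_ge0 ltW.
Qed.

Lemma reN x : re (- x) = - re x.
Proof. by rewrite -mulN1r -(rmorph1 io) -rmorphN reZ mulN1r. Qed.

Lemma reB x y : re (x - y) = re x - re y.
Proof. by rewrite reD reN. Qed.

Lemma re_le_nrm x : re x <= nrm x.
Proof. by rewrite -(ler_ofR s) nrmE re_le_norm. Qed.

Lemma norm_re_le x : `|re x| <= nrm x.
Proof.
by rewrite ler_norml re_le_nrm andbT lerNl -reN (le_trans (re_le_nrm _))// /nrm normrN.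
Qed.

Lemma nrm_le x a : (nrm x <= a) = (`|x| <= io a).
Proof. by rewrite -(ler_ofR s) nrmE. Qed.

Lemma le_nrm x a : (a <= nrm x) = (io a <= `|x|).
Proof. by rewrite -(ler_ofR s) nrmE. Qed.

Lemma nrm_ge0 x : 0 <= nrm x.
Proof. by rewrite le_nrm rmorph0. Qed.

Lemma nrmM x y : nrm (x * y) = nrm x * nrm y.
Proof. by apply: (fmorph_inj io); rewrite rmorphM !nrmE normrM. Qed.

Lemma nrmD x y : nrm (x + y) <= nrm x + nrm y.
Proof. by rewrite nrm_le rmorphD !nrmE ler_normD. Qed.

Lemma nrmB x y : nrm (x - y) <= nrm x + nrm y.
Proof. by rewrite nrm_le rmorphD !nrmE ler_normB. Qed.

Lemma gt0_ofR x : 0 < x -> exists2 a, 0 < a & x = io a.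
Proof. by move=> x0; exists (re x); rewrite ?reK ?ltW// -ofR_gt0 reK// ltW. Qed.

Lemma polar x : exists2 w : F, `|w| = 1 & w * x = `|x|.
Proof.
have [->|x0] := eqVneq x 0; first by exists 1; rewrite ?normr1// mulr0 normr0.
by exists (`|x| / x); rewrite ?divfK// normrM normfV normr_id divff// normr_eq0.
Qed.

End real_structure_theory.

(** The order of a numFieldType need not be total and carries no order topology,
    so closedness is checked by hand; a real radius is comparable with norms. *)
Lemma closed_norm_le (F : numFieldType) (V : normedModType F) (v : V) (r : F) :
  r \is Num.real -> closed [set x | `|x - v| <= r].
Proof.
move=> rr x clx; rewrite /= real_leNgt//; apply/negP => rx.
have [|y []] := clx (ball x (`|x - v| - r)); first by apply: nbhsx_ballx; rewrite subr_gt0.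
rewrite -ball_normE/= => yr; rewrite ltrBrDr => xy.
have := lt_le_trans xy (ler_distD y x v); rewrite ltrD2l => /lt_le_trans/(_ yr).
by rewrite ltxx.
Qed.

Section instances.
Variable R : realType.

Lemma real_parallelogram (x y : R) :
  `|x + y| ^+ 2 + `|x - y| ^+ 2 = (`|x| ^+ 2 + `|y| ^+ 2) *+ 2.
Proof. by rewrite !real_normK ?num_real//; ring. Qed.

Lemma real_compact_ball (r : R) : compact [set x : R^o | `|x| <= r].
Proof.
have -> : [set x : R^o | `|x| <= r] = `[- r, r]%classic.
  by apply/seteqP; split=> x /=; rewrite in_itv/= ler_norml.
exact: segment_compact.
Qed.

Lemma real_re_le_norm (x : R) : (idfun x : R) <= `|x|.
Proof. exact: ler_norm. Qed.

Definition real_real_structure : real_structure R R :=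
  @RealStructure R R idfun idfun (fun _ _ => erefl) (fun _ _ => erefl)
    (fun _ _ => erefl) (fun _ _ => erefl) erefl real_re_le_norm
    real_parallelogram real_compact_ball.

Local Open Scope complex_scope.

Lemma complex_reK (x : R[i]) : 0 <= x -> (complex.Re x)%:C = x.
Proof. by case: x => a b; rewrite lecE/= => /andP[/eqP ->]. Qed.

Lemma complex_ReD (x y : R[i]) : complex.Re (x + y) = complex.Re x + complex.Re y.
Proof. by case: x y => ? ? []. Qed.

Lemma complex_ReZ a (x : R[i]) : complex.Re (a%:C * x) = a * complex.Re x.
Proof. by case: x => ? ?/=; rewrite mul0r subr0. Qed.

Lemma complex_re_le_norm (x : R[i]) : (complex.Re x)%:C <= `|x|.
Proof. by apply: le_trans (normc_ge_Re x); rewrite lecR ler_norm. Qed.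

Lemma complex_parallelogram (x y : R[i]) :
  `|x + y| ^+ 2 + `|x - y| ^+ 2 = (`|x| ^+ 2 + `|y| ^+ 2) *+ 2.
Proof.
rewrite -!add_Re2_Im2 -!rmorphD -rmorphMn/=; congr (_%:C).
case: x y => a b [c d] /=. by ring.
Qed.

Lemma complex_compact_ball (r : R[i]) : compact [set x : R[i]^o | `|x| <= r].
Proof.
pose f (p : R * R) : R[i]^o := p.1 +i* p.2.
have cf : continuous f.
  move=> p; apply/cvgrPdist_lt => e; rewrite ltcE/= => /andP[/eqP Ime e0].
  have -> : e = (complex.Re e)%:C by case: e Ime {e0} => x y /= ->.
  have e2 : 0 < complex.Re e / 2 by rewrite divr_gt0.
  exists (ball p.1 (complex.Re e / 2), ball p.2 (complex.Re e / 2)).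
    by split; exact: nbhsx_ballx.
  move=> [a b] []/=; rewrite -!ball_normE/= => pa pb.
  by rewrite (le_lt_trans (normc_le_ReIm _))// ltcR/= [ltRHS]splitr ltrD.
have [r0|r0] := boolP (0 <= r); last first.
  rewrite (_ : mkset _ = set0); first exact: compact0.
  by rewrite -subset0 => x /= xr; move/negP: r0; apply; exact: le_trans xr.
pose B := [set x : R | `|x| <= complex.Re r].
have cB : compact (f @` (B `*` B)).
  apply: continuous_compact; first exact: continuous_subspaceT.
  by apply: compact_setX; exact: real_compact_ball.
apply: (subclosed_compact _ cB).
  rewrite (_ : mkset _ = [set x : R[i]^o | `|x - 0| <= r]).
    exact/closed_norm_le/ger0_real.
  by apply/seteqP; split=> x /=; rewrite subr0.
move=> x /= xr; exists (complex.Re x, complex.Im x); last by case: x {xr}.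
rewrite -(complex_reK r0) in xr.
by split => /=; rewrite /B/= -lecR (le_trans _ xr)// ?normc_ge_Re// normc_ge_Im.
Qed.

Definition complex_real_structure : real_structure R R[i] :=
  @RealStructure R R[i] (real_complex R) (@complex.Re R) (@lecR R) complex_reK
    complex_ReD complex_ReZ erefl complex_re_le_norm
    complex_parallelogram complex_compact_ball.

End instances.

(** * Rosenthal's disjointness lemma *)

(** [V i S] stands for the mass that the i-th measure gives to the supremum of
    the sets indexed by S; only superadditivity is available, since a finitely
    additive measure may charge the boundary of an infinite union. Split the
    indices into infinitely many infinite classes. Either one class works, or
    each class p contains an index whose measure loses mass e to the rest of
    its class; those indices, one per class, form a subfamily on which the
    total mass has dropped by e. This can happen only finitely often. *)
Lemma rosenthal_disjoint (R : realType) (V : nat -> set nat -> R) (e C : R) :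
  (forall i S, 0 <= V i S) ->
  (forall i S T, S `&` T = set0 -> V i S + V i T <= V i (S `|` T)) ->
  (forall i, V i setT <= C) -> 0 < e ->
  exists2 s : nat -> nat, injective s & forall i, V (s i) (s @` [set~ i]) <= e.
Proof.
move=> V0 VD VC e0.
have VS i S T : S `<=` T -> V i S <= V i T.
  move=> ST; have <- : S `|` (T `\` S) = T by rewrite setDUK.
  by apply: le_trans (VD i _ _ _); rewrite ?lerDl// setDIK.
have [n Cn] : exists n : nat, C <= n%:R * e.
  exists (Num.truncn (C / e)).+1; rewrite -ler_pdivrMr//.
  exact/ltW/truncnS_gt.
have {Cn VC} : forall i, V i setT <= n%:R * e by move=> i; exact: le_trans Cn.
elim: n V V0 VD VS => [|n IH] V V0 VD VS VC.
  exists id => // i; apply: (le_trans (VS _ _ setT _)) => //.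
  by apply: (le_trans (VC i)); rewrite mul0r ltW.
pose T (p q : nat) : nat := pickle (p, q).
have TI p q p' q' : T p q = T p' q' -> p = p' /\ q = q'.
  by move=> /(pcan_inj pickleK)[].
have [[p Tp]|/forallNP noT] := pselect (exists p, forall q,
    V (T p q) (T p @` [set~ q]) <= e).
  by exists (T p) => // q q' /TI[].
have {}noT p : {q | e < V (T p q) (T p @` [set~ q])}.
  apply: cid; have /existsNP[q /negP] := noT p; rewrite -ltNge; by exists q.
pose f p := T p (sval (noT p)).
have fI : injective f by move=> p p' /TI[].
have [|||i|s sI sV] := IH (fun i S => V (f i) (f @` S)).
- by [].
- move=> i S S' SS'; rewrite image_setU; apply: VD.
  rewrite -subset0 => _ [[x Sx <-] [y S'y /fI yx]].
  by have : (S `&` S') x; [split => //; rewrite -yx|rewrite SS'].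
- by move=> i S S' SS'; apply: VS; exact: image_subset.
- have := VC (f i); have := svalP (noT i); set q := sval _ => eq Vf.
  have : V (f i) (range f) + V (f i) (T i @` [set~ q]) <= n.+1%:R * e.
    apply: le_trans Vf; apply: le_trans (VD _ _ _ _) _; last exact: VS.
    rewrite -subset0 => _ [[j _ <-] [r rq /TI[ij rj]]].
    by apply: rq; rewrite rj -ij.
  rewrite -natr1 mulrDl mul1r -/(f i) => h.
  rewrite -(lerD2r e); apply: le_trans h; rewrite lerD2l; exact/ltW.
exists (f \o s); first exact: inj_comp.
by move=> i; have := sV i; rewrite /= image_comp.
Qed.

(** * A one-sided Goldstine theorem *)

Section goldstine.
Variables (R : realType) (F : scalarFieldType) (s : real_structure R F).
Local Notation io := (ofR s).
Local Notation re := (re s).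

Lemma unit_ball0 (X : normedModType F) : unit_ball (0 : X).
Proof. by rewrite /unit_ball/= normr0 ler01. Qed.

Lemma unit_ballZ (X : normedModType F) (w : F) (x : X) :
  `|w| <= 1 -> unit_ball x -> unit_ball (w *: x).
Proof. by move=> w1 x1; rewrite /unit_ball/= normrZ mulr_ile1. Qed.

Lemma unit_ball_conv (X : normedModType F) (t : R) (x y : X) : 0 <= t <= 1 ->
  unit_ball x -> unit_ball y -> unit_ball (io (1 - t) *: x + io t *: y).
Proof.
move=> /andP[t0 t1] x1 y1; have t1' : 0 <= 1 - t by rewrite subr_ge0.
rewrite /unit_ball/= (le_trans (ler_normD _ _))// !normrZ !norm_ofR !ger0_norm//.
rewrite -(rmorph1 io) -[in leRHS](subrK t 1) [leRHS]rmorphD/=.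
by rewrite lerD// ler_piMr// ofR_ge0.
Qed.

Lemma dual_le (X : normedModType F) (f : dual X) x : `|f x| <= `|f| * `|x|.
Proof.
have [->|x0] := eqVneq x 0; first by rewrite (linear0 f) !normr0 mulr0.
rewrite -ler_pdivrMr ?normr_gt0// mulrC -[`|x|^-1]ger0_norm ?invr_ge0// -normrM.
rewrite -[_ * _]/(_ *: f x : F^o) -linearZ/=; apply: dual_norm_ub.
by rewrite /unit_ball/= normrZ normfV normr_id mulVf// normr_eq0.
Qed.

Lemma dual_le_unit (X : normedModType F) (f : dual X) x :
  unit_ball x -> `|f x| <= `|f|.
Proof. by move=> x1; apply: (le_trans (dual_le f x)); rewrite ler_piMr. Qed.

Lemma bidual_le_unit (X : normedModType F) (phi : dual (dual X)) f :
  unit_ball phi -> `|phi f| <= `|f|.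
Proof. by move=> phi1; apply: (le_trans (dual_le phi f)); rewrite ler_piMl. Qed.

Lemma dual_norm_le_re (X : normedModType F) (f : dual X) (a : R) :
  (forall x, unit_ball x -> re (f x) <= a) -> `|f| <= io a.
Proof.
move=> fa; apply: dual_norm_le => [|x x1].
  rewrite ofR_ge0; have := fa _ (unit_ball0 X).
  by rewrite linear0 -(rmorph0 io) re_ofR.
have [w w1 wfx] := polar (f x).
have {}wfx : f (w *: x) = `|f x| by rewrite linearZ.
have h : io (re (f (w *: x))) = f (w *: x) by rewrite reK// wfx.
rewrite -[leLHS]wfx -h ler_ofR.
by apply: fa; apply: unit_ballZ; rewrite ?w1.
Qed.

Lemma dual_sumE (X : normedModType F) n (f : 'I_n -> dual X) x :
  (\sum_i f i) x = \sum_i f i x.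
Proof. by elim/big_ind2: _ => // g a h b <- <-. Qed.

Lemma re_sum n (f : 'I_n -> F) : re (\sum_i f i) = \sum_i re (f i).
Proof.
elim/big_ind2: _ => [|a b c d <- <-|//]; last by rewrite reD.
by rewrite -(rmorph0 io) re_ofR.
Qed.

Lemma dual_reZ (X : normedModType F) (f : dual X) (a : R) x :
  re (f (io a *: x)) = a * re (f x).
Proof. by rewrite -reZ; congr re; rewrite linearZ. Qed.

(** Minimise over the unit ball the squared distance J between the values
    [re (th i z)] and [re (phi (th i))]. At a near-minimiser z, the functional
    f weighted by the residuals w almost attains its norm at z, because moving
    from z towards any y in the ball cannot decrease J to first order. As
    [re (phi f)] is at most that norm, [re (phi f) - re (f z)], which equals
    J z, is almost nonpositive. *)
Lemma goldstine (X : normedModType F) n (th : 'I_n -> dual X)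
    (phi : dual (dual X)) (e : R) : unit_ball phi -> 0 < e ->
  exists2 z : X, unit_ball z & forall i, re (phi (th i)) - e <= re (th i z).
Proof.
move=> phi1 e0.
pose a i := re (phi (th i)); pose t i z := re (th i z).
pose J z := \sum_i (a i - t i z) ^+ 2.
have [[z z1 Jz]|noz] := pselect (exists2 z, unit_ball z & J z <= e ^+ 2).
  exists z => // i; rewrite -/(a i) -/(t i z) lerBlDr -lerBlDl.
  rewrite (le_trans (ler_norm _))// -(@ler_pXn2r _ 2) ?nnegrE// ?(ltW e0)//.
  rewrite real_normK ?num_real// (le_trans _ Jz)// /J (bigD1 i)//= lerDl.
  by apply: sumr_ge0 => j _; exact: sqr_ge0.
have {}noz z : unit_ball z -> e ^+ 2 < J z.
  by move=> z1; rewrite ltNge; apply/negP => Jz; apply: noz; exists z.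
pose A := [set J z | z in @unit_ball F X].
have infA : has_inf A.
  split; first by exists (J 0), 0 => //; exact: unit_ball0.
  by exists (e ^+ 2) => _ [z /noz/ltW ? <-].
pose m i := nrm s `|th i|.
have tm i z : unit_ball z -> `|t i z| <= m i.
  move=> z1; apply: (le_trans (norm_re_le _ _)).
  by rewrite nrm_le nrmE normr_id dual_le_unit.
pose L := \sum_i (m i + m i) ^+ 2.
have L0 : 0 <= L by apply: sumr_ge0 => i _; exact: sqr_ge0.
have e20 : 0 < e ^+ 2 by rewrite exprn_gt0.
have D0 : 0 < 1 + L + e ^+ 2 by lra.
(* The step length: at most 1, and d (1 + L) / 2 < e ^ 2, where d (1 + L) / 2 is
   the error in the first-order condition. *)
pose d := e ^+ 2 / (1 + L + e ^+ 2).
have dD : d * (1 + L + e ^+ 2) = e ^+ 2 by rewrite /d divfK// lt0r_neq0.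
have d0 : 0 < d by rewrite divr_gt0.
have d1 : d <= 1 by rewrite ler_pdivrMr// mul1r lerDr; lra.
have [|_ [z z1 <-] Jz] := @inf_adherent _ A (d ^+ 2) _ infA.
  by rewrite exprn_gt0.
pose w i := a i - t i z.
pose f : dual X := \sum_i io (w i) *: th i.
have fE y : re (f y) = \sum_i w i * t i y.
  by rewrite dual_sumE re_sum; apply: eq_bigr => i _; rewrite reZ.
have phifE : re (phi f) = \sum_i w i * a i.
  rewrite linear_sum re_sum; apply: eq_bigr => i _.
  by rewrite dual_reZ.
have fle y : unit_ball y -> re (f y) <= re (f z) + d * (1 + L) / 2.
  move=> y1.
  have zy1 : unit_ball (io (1 - d) *: z + io d *: y).
    by apply: unit_ball_conv => //; rewrite d1 ltW.
  have Jzy : inf A <= J (io (1 - d) *: z + io d *: y).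
    by apply: ge_inf; [exact: infA.2|exists (io (1 - d) *: z + io d *: y)].
  have JE : J (io (1 - d) *: z + io d *: y) =
      J z - 2 * d * (re (f y) - re (f z)) + d ^+ 2 * \sum_i (t i y - t i z) ^+ 2.
    rewrite !fE -sumrB !mulr_sumr -sumrN -!big_split/=.
    apply: eq_bigr => i _.
    rewrite [t i (_ + _)]/t linearD reD !dual_reZ -/(t i z) -/(t i y) /w; ring.
  have rL : \sum_i (t i y - t i z) ^+ 2 <= L.
    apply: ler_sum => i _; rewrite -[leLHS]real_normK ?num_real//.
    rewrite ler_pXn2r ?nnegrE// ?addr_ge0 ?nrm_ge0//.
    by rewrite (le_trans (ler_normB _ _))// lerD// tm.
  have d2L : d ^+ 2 * \sum_i (t i y - t i z) ^+ 2 <= d ^+ 2 * L.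
    by rewrite ler_wpM2l// sqr_ge0.
  have : d * (2 * (re (f y) - re (f z))) <= d * (d * (1 + L)).
    by move: Jzy Jz d2L; rewrite JE; lra.
  by rewrite ler_pM2l// => ?; lra.
have := dual_norm_le_re fle; have := bidual_le_unit f phi1.
move=> /le_trans/[apply]; rewrite -nrm_le.
move=> /(le_trans (re_le_nrm s (phi f))); rewrite phifE => h.
have := noz _ z1.
have -> : J z = \sum_i w i * a i - re (f z).
  by rewrite fE -sumrB; apply: eq_bigr => i _; rewrite /w; ring.
have : 0 < d * e ^+ 2 by rewrite mulr_gt0.
by lra.
Qed.

End goldstine.

(** * Clopen sets and patching in sigma-Stonean spaces *)

Section stonean.
Variables (R : realType) (F : scalarFieldType) (s : real_structure R F).
Local Notation io := (ofR s).

(** Covering compactness applied along the filter of finite lists, ordered by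
    inclusion. *)
Lemma ball_net (e : F) : 0 < e -> exists l : seq F,
  forall x : F, `|x| <= 1 -> exists2 v, v \in l & `|x - v| < e.
Proof.
move=> e0; have /compact_near_coveringP cB := @compact_closed_ball0 _ _ s 1.
pose G := filter_from [set: seq F] (fun l0 => [set l : seq F | {subset l0 <= l}]).
have GF : ProperFilter G.
  apply: filter_from_proper => [|l0 _]; last by exists l0 => v.
  apply: filter_from_filter => [|l1 l2 _ _]; first by exists [::].
  by exists (l1 ++ l2) => // l l12; split=> v vl; apply: l12; rewrite mem_cat vl ?orbT.
have [|l0 _ cl] := cB _ G (fun l x => exists2 v, v \in l & `|x - v| < e) GF.
  move=> x _; exists ([set x' | `|x' - x| < e], [set l : seq F | (x : F) \in l]).
    split; last by exists [:: x] => // l /(_ x); apply; rewrite mem_head.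
    change (nbhs (x : F^o) [set x' : F^o | `|x' - x| < e]).
    have := nbhsx_ballx (x : F^o) e e0; apply: filterS => x' /=.
    by rewrite -ball_normE/= distrC.
  by move=> [x' l] []/= x'x xl; exists x.
by exists l0 => x; apply: (cl l0 _ x).
Qed.

Variable K : compactHausdorffType.
Hypothesis KS : sigma_stonean K.

Lemma nrm_continuous (f : cfun K F) : continuous (fun t => nrm s (f t)).
Proof.
move=> t; apply/cvgrPdist_le => e e0.
have /cvgrPdist_le/(_ (io e)) := @cfun_continuous _ _ f t.
rewrite ofR_gt0 => /(_ e0); apply: filterS => t' ftt'.
rewrite -(ler_ofR s) -norm_ofR rmorphB !nrmE; apply: le_trans ftt'.
exact: ler_dist_dist.
Qed.

(** The cozero set is the union of the closed sets where [g] is at most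
    [- 1 / (n + 1)], so it is an open F_sigma. *)
Lemma clopen_closure_lt0 (g : K -> R) : continuous g ->
  clopen (closure [set t | g t < 0]).
Proof.
move=> cg; split; last exact: closed_closure.
apply: KS; first by apply: (@open_comp _ _ g [set r | r < 0]) => [t _|];
    [exact: cg|exact: open_lt].
exists (fun n => [set t | g t <= - n.+1%:R^-1]).
  move=> n; apply: (@closed_comp _ _ g [set r | r <= - n.+1%:R^-1]) => [t _|].
    exact: cg.
  exact: closed_le.
apply/seteqP; split=> [t /= gt0|t [n _ /= /le_lt_trans]]; last first.
  by apply; rewrite oppr_lt0 invr_gt0.
have gt0' : 0 < - g t by rewrite oppr_gt0.
exists (Num.truncn (- g t)^-1) => //=; rewrite lerNr.
by rewrite -[leRHS]invrK lef_pV2 ?posrE ?invr_gt0//; exact/ltW/truncnS_gt.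
Qed.

Lemma clopen_closure_lt (f : cfun K F) (e : R) :
  clopen (closure [set t | `|f t| < io e]).
Proof.
rewrite (_ : mkset _ = [set t | nrm s (f t) - e < 0]).
  apply: clopen_closure_lt0 => t; apply: cvgB; first exact: nrm_continuous.
  exact: cvg_cst.
by apply/seteqP; split=> t /=; rewrite subr_lt0 -(ltr_ofR s) nrmE.
Qed.

Lemma clopen_closure_gt (f : cfun K F) (e : R) :
  clopen (closure [set t | io e < `|f t|]).
Proof.
rewrite (_ : mkset _ = [set t | e - nrm s (f t) < 0]).
  apply: clopen_closure_lt0 => t; apply: cvgB; first exact: cvg_cst.
  exact: nrm_continuous.
by apply/seteqP; split=> t /=; rewrite subr_lt0 -(ltr_ofR s) nrmE.
Qed.

Lemma cfun_closed_le (f : cfun K F) (e : R) : closed [set t | `|f t| <= io e].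
Proof.
rewrite (_ : mkset _ = [set t | nrm s (f t) <= e]).
  apply: (@closed_comp _ _ (fun t => nrm s (f t)) [set r | r <= e]) => [t _|].
    exact: nrm_continuous.
  exact: closed_le.
by apply/seteqP; split=> t /=; rewrite nrm_le.
Qed.

Lemma cfun_closed_ge (f : cfun K F) (e : R) : closed [set t | io e <= `|f t|].
Proof.
rewrite (_ : mkset _ = [set t | e <= nrm s (f t)]).
  apply: (@closed_comp _ _ (fun t => nrm s (f t)) [set r | e <= r]) => [t _|].
    exact: nrm_continuous.
  exact: closed_ge.
by apply/seteqP; split=> t /=; rewrite le_nrm.
Qed.

Lemma clopen_closure_bigcup (S : set nat) (B : nat -> set K) :
  (forall j, clopen (B j)) -> clopen (closure (\bigcup_(j in S) B j)).
Proof.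
move=> cB; split; last exact: closed_closure.
apply: KS; first by apply: bigcup_open => j _; exact: (cB j).1.
exists (fun j => if j \in S then B j else set0).
  by move=> j; case: ifP => _; [exact: (cB j).2|exact: closed0].
apply/seteqP; split=> [t [j Sj Bt]|t [j _]]; first by exists j => //; rewrite mem_set.
by case: ifPn => // /set_mem Sj Bt; exists j.
Qed.

Lemma closure_disjoint (A B : set K) : open B -> A `&` B = set0 ->
  closure A `&` B = set0.
Proof.
move=> oB AB; rewrite -subset0 => t [clA Bt].
by have [u] := clA _ (open_nbhs_nbhs (conj oB Bt)); rewrite AB.
Qed.

Definition glue_fun (A : set K) (f g : cfun K F) : K -> F^o :=
  fun t => if t \in A then f t else g t.

Lemma glue_continuous A f g : clopen A -> continuous (glue_fun A f g).
Proof.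
move=> [oA cA] t; rewrite /glue_fun /continuous_at; case: ifPn => [/set_mem At|].
  apply: cvg_trans (@cfun_continuous _ _ f t); apply: near_eq_cvg.
  by apply: filterS (open_nbhs_nbhs (conj oA At)) => t' At'; rewrite mem_set.
rewrite notin_setE => At; apply: cvg_trans (@cfun_continuous _ _ g t).
apply: near_eq_cvg; have oAc : open (~` A) by rewrite openC.
apply: filterS (open_nbhs_nbhs (conj oAc At)) => t' At'.
by rewrite memNset.
Qed.

Definition glue A f g (cA : clopen A) : cfun K F :=
  CFun (mem_set (@glue_continuous A f g cA)).

Lemma glue_in A f g (cA : clopen A) t : A t -> glue f g cA t = f t.
Proof. by move=> At; rewrite /glue/= /glue_fun mem_set. Qed.

Lemma glue_out A f g (cA : clopen A) t : ~ A t -> glue f g cA t = g t.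
Proof. by move=> At; rewrite /glue/= /glue_fun memNset. Qed.

Lemma cst_cfun_subproof (v : F) : (fun=> v) \in @cfun_pred K F.
Proof. by rewrite inE; exact: cst_continuous. Qed.

Definition cst_cfun v : cfun K F := CFun (cst_cfun_subproof v).

(** For v in a finite e-net of the unit ball, let O v be the closure of the part
    of the union where the prescribed function lies within e of v. The O v are
    clopen and cover the union, so a step function that takes the value v on
    O v is continuous and is within e of the prescribed values. *)
Lemma patch_approx (S : set nat) (B : nat -> set K) (y : nat -> cfun K F)
    (z : cfun K F) (e : R) :
  (forall j, clopen (B j)) ->
  (forall i j, i <> j -> B i `&` B j = set0) ->
  (forall j t, `|y j t| <= 1) -> 0 < e ->
  exists x : cfun K F,
    (forall j t, S j -> B j t -> `|x t - y j t| <= io e) /\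
    (forall t, ~ closure (\bigcup_(j in S) B j) t -> x t = z t).
Proof.
move=> cB dB y1 e0; have [|l lP] := @ball_net (io e); first by rewrite ofR_gt0.
pose D v j := closure [set t | `|(y j - cst_cfun v) t| < io e].
have Dle v j t : D v j t -> `|v - y j t| <= io e.
  move=> Dt; rewrite distrC.
  have /closure_id h := @cfun_closed_le (y j - cst_cfun v) e.
  change ([set t | `|(y j - cst_cfun v) t| <= io e] t); rewrite h.
  by apply: closure_subset Dt => u /ltW.
have cBD v j : clopen (B j `&` D v j).
  have [oD cD] := @clopen_closure_lt (y j - cst_cfun v) e.
  by have [oB' cB'] := cB j; split; [exact: openI|exact: closedI].
pose O v := closure (\bigcup_(j in S) (B j `&` D v j)).
have cO v : clopen (O v) by exact: clopen_closure_bigcup.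
have Ole v j t : O v t -> B j t -> `|v - y j t| <= io e.
  move=> Ot Bt; apply: Dle; apply: contrapT => Dt.
  have [|u [[k _ [Bk Dk]] [Bj /= nD]]] :=
      Ot (B j `&` ~` D v j).
    apply: open_nbhs_nbhs; split => //; apply: openI; first exact: (cB j).1.
    by rewrite openC; exact: closed_closure.
  have [kj|/eqP/dB kj] := eqVneq k j; first by apply: nD; rewrite -kj.
  by have : (B k `&` B j) u by []; rewrite kj.
have OV v t : O v t -> closure (\bigcup_(j in S) B j) t.
  by apply: closure_subset => u [j Sj [Bj _]]; exists j.
have [x [xO xV]] : exists x : cfun K F,
    (forall j t, S j -> B j t -> (exists2 v, v \in l & O v t) ->
       `|x t - y j t| <= io e) /\
    (forall t, ~ closure (\bigcup_(j in S) B j) t -> x t = z t).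
  elim: l {lP} => [|v l [x [xO xV]]]; first by exists z; split=> // j t _ _ [].
  exists (glue (cst_cfun v) x (cO v)); split=> [j t Sj Bt|t Vt].
    have [Ot _|Ot] := pselect (O v t); first by rewrite glue_in//; exact: Ole.
    rewrite glue_out// => -[w]; rewrite in_cons => /predU1P[->//|wl Ow].
    by apply: xO => //; exists w.
  by rewrite glue_out ?xV// => /OV.
exists x; split=> // j t Sj Bt; apply: xO => //.
have [v vl yv] := lP _ (y1 j t); exists v => //.
apply: subset_closure; exists j => //; split=> //.
exact: subset_closure.
Qed.

(** The supremum of disjoint clopen sets is C*-embedded: a bounded function that
    is continuous on each piece extends continuously. The step functions of
    [patch_approx] form a Cauchy filter, since agreement up to a constant on
    the union passes to its closure, and the space of continuous functions is
    complete. *)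
Lemma patch (S : set nat) (B : nat -> set K) (y : nat -> cfun K F) (z : cfun K F) :
  (forall j, clopen (B j)) ->
  (forall i j, i <> j -> B i `&` B j = set0) ->
  (forall j t, `|y j t| <= 1) -> (forall t, `|z t| <= 1) ->
  exists x : cfun K F, [/\ forall t, `|x t| <= 1,
    forall j t, S j -> B j t -> x t = y j t &
    forall t, ~ closure (\bigcup_(j in S) B j) t -> x t = z t].
Proof.
move=> cB dB y1 z1; set U := \bigcup_(j in S) B j.
pose A e := [set x : cfun K F |
  (forall j t, S j -> B j t -> `|x t - y j t| <= io e) /\
  (forall t, ~ closure U t -> x t = z t)].
pose G := filter_from [set e : R | 0 < e] A.
have AS e e' x : e <= e' -> A e x -> A e' x.
  move=> ee' [xU xV]; split=> // j t Sj Bt.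
  by rewrite (le_trans (xU j t Sj Bt))// ler_ofR.
have GF : ProperFilter G.
  apply: filter_from_proper => [|e /= e0]; last first.
    by have [x xP] := patch_approx S z cB dB y1 e0; exists x.
  apply: filter_from_filter => [|e e' /= e0 e'0]; first by exists 1 => /=.
  exists (Num.min e e'); first by rewrite /= lt_min e0.
  by move=> x Ax; split; apply: AS Ax; rewrite ge_min lexx ?orbT.
have dense_le (x : cfun K F) (a : R) : (forall t, U t -> `|x t| <= io a) ->
    (forall t, ~ closure U t -> `|x t| <= io a) -> forall t, `|x t| <= io a.
  move=> xU xV t; have [Vt|/xV//] := pselect (closure U t).
  have /closure_id h := @cfun_closed_le x a.
  change ([set t | `|x t| <= io a] t); rewrite h.
  exact: closure_subset Vt.
have cG : cauchy G.
  apply/cauchyP => e /(gt0_ofR s)[a a0 ->].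
  have a3 : 0 < a / 3 by rewrite divr_gt0.
  have [x [xU xV]] := patch_approx S z cB dB y1 a3.
  exists x; exists (a / 3) => // x' [x'U x'V]; rewrite -ball_normE/=.
  apply: (@le_lt_trans _ _ (io (a / 3 + a / 3))); last by rewrite ltr_ofR; lra.
  apply: cfun_norm_le; first by rewrite ofR_ge0 addr_ge0 ?ltW.
  apply: dense_le => t.
    move=> [j Sj Bt].
    rewrite [(x - x') t](_ : _ = (x t - y j t) - (x' t - y j t)); last first.
      by rewrite opprB addrA subrK.
    by rewrite rmorphD/= (le_trans (ler_normB _ _))// lerD// ?xU ?x'U.
  move=> Vt; rewrite [(x - x') t](_ : _ = x t - x' t)// xV ?x'V// subrr normr0.
  by rewrite ofR_ge0 addr_ge0 ?ltW.
have /cvg_ex[x Gx] := @cfun_cauchy_cvg _ _ G GF cG.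
have near_x (e : R) : 0 < e ->
    exists2 x', A e x' & forall t, `|x t - x' t| <= io e.
  move=> e0; have ie0 : 0 < io e by rewrite ofR_gt0.
  have Ge : G (ball x (io e)) by apply: Gx; exact: nbhsx_ballx.
  have GA : G (A e) by exists e.
  have [x' [Ax']] := filter_ex (filterI GA Ge).
  rewrite -ball_normE/= => xx'.
  exists x' => // t; apply: le_trans (ltW xx'); exact: (cfun_norm_ub (x - x') t).
have eq_lim (a b : F) : (forall e : R, 0 < e -> `|a - b| <= io (e + e)) -> a = b.
  move=> ab; apply/eqP; rewrite -subr_eq0 -normr_le0; apply/ler_addgt0Pr => e.
  move=> /(gt0_ofR s)[c c0 ->]; rewrite add0r [c]splitr; apply: ab.
  by rewrite divr_gt0.
have xU j t : S j -> B j t -> x t = y j t.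
  move=> Sj Bt; apply: eq_lim => e e0; have [x' [x'U _] xx'] := near_x e e0.
  rewrite (le_trans (ler_distD (x' t) _ _))// rmorphD lerD//.
  exact: x'U.
have xV t : ~ closure U t -> x t = z t.
  move=> Vt; apply: eq_lim => e e0; have [x' [_ x'V] xx'] := near_x e e0.
  by rewrite -(x'V t Vt) (le_trans (xx' t))// ler_ofR lerDr ltW.
exists x; split=> //; rewrite -(rmorph1 io); apply: dense_le => t.
  by move=> [j Sj Bt]; rewrite (xU j)// rmorph1.
by move=> Vt; rewrite xV// rmorph1.
Qed.

End stonean.

(** * The total variation of a functional *)

Section variation.
Variables (R : realType) (F : scalarFieldType) (s : real_structure R F).
Variable K : compactHausdorffType.
Local Notation io := (ofR s).
Local Notation re := (re s).
Local Notation C := (cfun K F).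
Implicit Types (nu : dual C) (f g : C).

Definition dominates f g := forall t, `|g t| <= f t.

(** The value at [f >= 0] of the modulus of the real part of [nu]. It plays the
    role of the total variation measure. *)
Definition variation nu f : R := sup [set re (nu g) | g in dominates f].

Lemma dominates_ge0 f g : dominates f g -> forall t, 0 <= f t.
Proof. by move=> fg t; exact: le_trans (fg t). Qed.

Lemma dominates0 f : (forall t, 0 <= f t) -> dominates f 0.
Proof. by move=> f0 t; rewrite normr0. Qed.

Lemma dominatesN f g : dominates f g -> dominates f (- g).
Proof. by move=> fg t; rewrite [(- g) t](_ : _ = - g t)// normrN. Qed.

Lemma dominatesD f f' g g' : dominates f g -> dominates f' g' ->
  dominates (f + f') (g + g').
Proof.
by move=> fg fg' t; apply: le_trans (ler_normD (g t) (g' t)) _; exact: lerD.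
Qed.

Lemma re_dualB nu f g : re (nu (f - g)) = re (nu f) - re (nu g).
Proof. by rewrite -reB; congr re; rewrite linearB. Qed.

Lemma re_dualD nu f g : re (nu (f + g)) = re (nu f) + re (nu g).
Proof. by rewrite -reD; congr re; rewrite linearD. Qed.

Lemma re_dualN nu f : re (nu (- f)) = - re (nu f).
Proof. by rewrite -reN; congr re; rewrite linearN. Qed.

Lemma re_dual_le nu g (a : R) : 0 <= a -> (forall t, `|g t| <= io a) ->
  re (nu g) <= nrm s `|nu| * a.
Proof.
move=> a0 ga; apply: (le_trans (re_le_nrm _ _)).
rewrite nrm_le rmorphM/= nrmE normr_id (le_trans (dual_le _ _))// ler_wpM2l//.
by apply: cfun_norm_le => //; rewrite ofR_ge0.
Qed.

Section basic.
Variables (nu : dual C) (f : C).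
Hypothesis f0 : forall t, 0 <= f t.

Lemma variation_has_sup : has_sup [set re (nu g) | g in dominates f].
Proof.
split; first by exists (re (nu 0)), 0 => //; exact: dominates0.
exists (nrm s `|nu| * nrm s `|f|) => _ [g fg <-].
apply: re_dual_le => [|t]; first exact: nrm_ge0.
rewrite nrmE normr_id (le_trans (fg t))// -[leLHS](ger0_norm (f0 t)).
exact: cfun_norm_ub.
Qed.

Lemma le_variation g : dominates f g -> re (nu g) <= variation nu f.
Proof. by move=> fg; apply: sup_ubound; [exact: variation_has_sup.2|exists g]. Qed.

Lemma norm_le_variation g : dominates f g -> `|re (nu g)| <= variation nu f.
Proof.
move=> fg; rewrite ler_norml le_variation// andbT lerNl -re_dualN.
exact/le_variation/dominatesN.
Qed.

Lemma variation_le a : (forall g, dominates f g -> re (nu g) <= a) ->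
  variation nu f <= a.
Proof.
move=> fa; apply: ge_sup; first exact: variation_has_sup.1.
by move=> _ [g fg <-]; exact: fa.
Qed.

Lemma variation_ge0 : 0 <= variation nu f.
Proof. exact: le_trans (norm_le_variation (dominates0 f0)). Qed.

End basic.

Lemma variation_bound nu f a : (forall t, 0 <= f t <= io a) -> 0 <= a ->
  variation nu f <= nrm s `|nu| * a.
Proof.
move=> fa a0; apply: variation_le => [t|g fg]; first by case/andP: (fa t).
by apply: re_dual_le => // t; apply: (le_trans (fg t)); case/andP: (fa t).
Qed.

Lemma le_variation_fun nu f f' : (forall t, 0 <= f t) -> (forall t, f t <= f' t) ->
  variation nu f <= variation nu f'.
Proof.
move=> f0 ff'; have f'0 t : 0 <= f' t by exact: le_trans (ff' t).
apply: variation_le => // g fg; apply: le_variation => // t.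
exact: le_trans (ff' t).
Qed.

Lemma cfun_scaleE (a : F) f t : (a *: f) t = a * f t. Proof. by []. Qed.

Lemma variationZ_le nu f (a : R) : (forall t, 0 <= f t) -> 0 < a ->
  variation nu (io a *: f) <= a * variation nu f.
Proof.
move=> f0 a0; have ia0 : 0 < io a by rewrite ofR_gt0.
apply: variation_le => [t|g fg].
  by rewrite cfun_scaleE mulr_ge0// ltW.
have -> : g = io a *: (io a^-1 *: g).
  by rewrite scalerA -rmorphM divff ?lt0r_neq0// rmorph1 scale1r.
rewrite dual_reZ ler_wpM2l ?(ltW a0)//; apply: le_variation => // t.
rewrite cfun_scaleE fmorphV normrM normfV (gtr0_norm ia0) ler_pdivrMl//.
Qed.

Lemma variationZ nu f (a : R) : (forall t, 0 <= f t) -> 0 < a ->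
  variation nu (io a *: f) = a * variation nu f.
Proof.
move=> f0 a0; apply/eqP; rewrite eq_le variationZ_le//=.
have af0 t : 0 <= (io a *: f) t.
  by rewrite cfun_scaleE mulr_ge0// ofR_ge0 ltW.
have a1 : 0 < a^-1 by rewrite invr_gt0.
have := variationZ_le nu af0 a1.
rewrite scalerA -rmorphM mulVf ?lt0r_neq0// rmorph1 scale1r.
by rewrite mulrC ler_pdivlMr// mulrC.
Qed.

Lemma variationD_ge nu f f' : (forall t, 0 <= f t) -> (forall t, 0 <= f' t) ->
  variation nu f + variation nu f' <= variation nu (f + f').
Proof.
move=> f0 f'0; have ff'0 t : 0 <= (f + f') t by rewrite addr_ge0 ?f0 ?f'0.
rewrite -lerBrDr; apply: variation_le => // g fg.
rewrite lerBrDr -lerBrDl; apply: variation_le => // g' fg'.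
by rewrite lerBrDl -re_dualD; apply: le_variation => //; exact: dominatesD.
Qed.

Section split.
Variables (g f h : C).
Hypothesis h0 : forall t, h t != 0.

Lemma mul_ratio_subproof : (fun t => g t * (f t / h t)) \in @cfun_pred K F.
Proof.
rewrite inE => t; apply: cvgM; first exact: cfun_continuous.
by apply: cvgM; [exact: cfun_continuous|apply: cvgV => //; exact: cfun_continuous].
Qed.

Definition mul_ratio : C := CFun mul_ratio_subproof.

End split.

(** Subadditivity needs the Riesz decomposition: g dominated by f + f' splits
    into g f / h and g f' / h with h = f + f'. Adding a small constant to h
    keeps the quotients continuous, at the cost of a uniformly small rest. *)
Lemma variationD nu f f' : (forall t, 0 <= f t) -> (forall t, 0 <= f' t) ->
  variation nu (f + f') = variation nu f + variation nu f'.
Proof.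
move=> f0 f'0; have ff'0 t : 0 <= (f + f') t by rewrite addr_ge0 ?f0 ?f'0.
apply/eqP; rewrite eq_le variationD_ge// andbT.
apply: variation_le => // g fg; apply/ler_addgt0Pr => e e0.
pose M := nrm s `|nu|; have M1 : 0 < M + 1 by rewrite ltr_wpDl ?nrm_ge0.
pose d := e / (M + 1); have d0 : 0 < d by rewrite divr_gt0.
have id0 : 0 < io d by rewrite ofR_gt0.
pose h : C := f + f' + cst_cfun K (io d).
have hE t : h t = f t + f' t + io d by [].
have h0 t : 0 < h t by rewrite hE ltr_wpDl// addr_ge0.
have hn0 t : h t != 0 by rewrite lt0r_neq0.
have gh t : `|g t| <= h t by apply: (le_trans (fg t)); rewrite hE lerDl ltW.
have dom (k : C) : (forall t, 0 <= k t) -> dominates k (mul_ratio g k hn0).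
  move=> k0 t; have kh0 : 0 <= k t / h t by apply: divr_ge0 => //; exact: ltW.
  rewrite /= normrM (ger0_norm kh0) mulrCA ler_piMr//.
  by rewrite ler_pdivrMr ?mul1r.
pose g1 := mul_ratio g f hn0; pose g2 := mul_ratio g f' hn0.
have gE : g = g1 + g2 + mul_ratio g (cst_cfun K (io d)) hn0.
  apply/val_inj/funext => t /=.
  change (g t = g t * (f t / h t) + g t * (f' t / h t) + g t * (io d / h t)).
  by rewrite -!mulrDr -!mulrDl -hE divff// mulr1.
rewrite gE !re_dualD lerD//; first by rewrite lerD// le_variation//; exact: dom.
apply: le_trans (_ : M * d <= _).
  by apply: re_dual_le => [|t]; [exact: ltW|apply: dom => t' /=; exact: ltW].
by rewrite /d mulrCA ger_pMr// ler_pdivrMr// mul1r lerDl.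
Qed.

End variation.

(** * Ultralimits of variations *)

Lemma ultra_cvg_compact (T : Type) (V : topologicalType) (G : set_system T)
    (f : T -> V) (A : set V) : UltraFilter G -> compact A ->
  (forall i, A (f i)) -> exists2 p, A p & f @ G --> p.
Proof.
move=> GU cA Af; have GA : G (f @^-1` A) by apply: filterS filterT => i _; exact: Af.
have [p [Ap Gp]] := cA (f @ G) _ GA; exists p => // B Bp.
have [//|GB] := in_ultra_setVsetC (f @^-1` B) GU.
by have [x []] := Gp (~` B) B GB Bp.
Qed.

Lemma injective_unbounded (e : nat -> nat) m : injective e -> exists i, (m <= e i)%N.
Proof.
move=> eI; apply: contrapT => /forallNP em.
have : e @` `I_m.+1 `<=` `I_m.
  by move=> _ [i _ <-]; rewrite /= ltnNge; apply/negP; exact: em.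
move=> /subset_card_le; rewrite (card_le_eql (inj_card_eq _)).
  by rewrite card_le_II ltnn.
by move=> i j _ _; exact: eI.
Qed.

(** The existence of projections in Hilbert spaces, in the form needed for a
    decreasing sequence of convex sets: d is the supremum of the minima of q,
    and two near-minimisers in a late set are close, since q at their midpoint
    cannot be much below d. *)
Lemma near_minimizers (R : realType) (T : Type) (A : nat -> set T) (q : T -> R)
    (dist : T -> T -> R) (M : R) :
  (forall n, A n !=set0) -> (forall m n, (m <= n)%N -> A n `<=` A m) ->
  (forall n z, A n z -> 0 <= q z <= M) ->
  (forall n z z', A n z -> A n z' ->
     exists2 m, A n m & dist z z' + 4 * q m = 2 * q z + 2 * q z') ->
  exists d,
    (forall n e, 0 < e -> exists2 z, A n z & q z <= d + e) /\
    (forall e, 0 < e -> exists N, forall z z', A N z -> A N z' ->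
       q z <= d + e -> q z' <= d + e -> dist z z' <= 8 * e).
Proof.
move=> A0 AS qM mid; pose d n := inf [set q z | z in A n].
have hI n : has_inf [set q z | z in A n].
  split; first by have [z Az] := A0 n; exists (q z), z.
  by exists 0 => _ [z /qM/andP[qz _] <-].
have dq n z : A n z -> d n <= q z.
  by move=> Az; apply: ge_inf; [exact: (hI n).2|exists z].
have hS : has_sup (range d).
  split; first by exists (d 0), 0.
  exists M => _ [n _ <-]; have [z Az] := A0 n.
  by rewrite (le_trans (dq _ _ Az))//; have /andP[] := qM _ _ Az.
exists (sup (range d)); split=> [n e e0|e e0].
  have [_ [z Az <-] qz] := inf_adherent e0 (hI n); exists z => //.
  rewrite (le_trans (ltW qz))// lerD2r; apply: sup_ubound; first exact: hS.2.
  by exists n.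
have [_ [N _ <-] dN] := sup_adherent e0 hS.
exists N => z z' Az Az' qz qz'; have [m Am mE] := mid _ _ _ Az Az'.
have := dq _ _ Am; lra.
Qed.

Section ultralimits.
Variables (R : realType) (F : scalarFieldType) (s : real_structure R F).
Variable K : compactHausdorffType.
Local Notation io := (ofR s).
Local Notation C := (cfun K F).

(** Defined for every set, so that it can be used without a proof of clopenness
    in its arguments; only its values on clopen sets are meaningful. *)
Definition indic (A : set K) : C :=
  if pselect (clopen A) is left cA then glue (cst_cfun K 1) 0 cA else 0.

Lemma indicE A t : clopen A -> indic A t = (if t \in A then 1 else 0).
Proof.
by rewrite /indic; case: pselect.
Qed.

Lemma indic_bounds A t : 0 <= indic A t <= 1.
Proof.
have [cA|ncA] := pselect (clopen A); first by rewrite indicE//; case: ifP; rewrite ler01 lexx.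
by rewrite /indic; case: pselect => // _; rewrite /= lexx ler01.
Qed.

Lemma indic_ge0 A t : 0 <= indic A t.
Proof. by have /andP[] := indic_bounds A t. Qed.

Lemma sqn_subproof (z : C) : (fun t => `|z t| ^+ 2) \in @cfun_pred K F.
Proof.
rewrite inE => t; rewrite /continuous_at.
have cz : `|z t'| @[t' --> t] --> (`|z t| : F^o).
  by apply: cvg_norm; exact: cfun_continuous.
exact: (cvgM cz cz).
Qed.

Definition sqn z : C := CFun (sqn_subproof z).

Lemma sqn_ge0 z t : 0 <= sqn z t.
Proof. by rewrite /= exprn_ge0. Qed.

Lemma sqn_parallelogram x y : sqn (x + y) + sqn (x - y) = (sqn x + sqn y) *+ 2.
Proof.
apply/val_inj/funext => t; rewrite mulr2n.
change (`|x t + y t| ^+ 2 + `|x t - y t| ^+ 2 =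
  (`|x t| ^+ 2 + `|y t| ^+ 2) + (`|x t| ^+ 2 + `|y t| ^+ 2)).
by rewrite (norm_parallelogram s) mulr2n.
Qed.

Lemma sqnZ a x : sqn (io a *: x) = io (a ^+ 2) *: sqn x.
Proof.
apply/val_inj/funext => t.
change (`|io a * x t| ^+ 2 = io (a ^+ 2) * `|x t| ^+ 2).
by rewrite normrM exprMn norm_ofR -rmorphXn/= real_normK ?num_real.
Qed.

Lemma cfun_unit_ballP (x : C) : unit_ball x <-> forall t, `|x t| <= 1.
Proof.
split=> [x1 t|x1]; first exact: le_trans (cfun_norm_ub x t) x1.
exact: cfun_norm_le.
Qed.

Implicit Types f g : C.

Variables (N : nat -> dual C) (M : R).
Hypothesis NM : forall k, `|N k| <= io M.

Let M0 : 0 <= M.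
Proof. by rewrite -(ofR_ge0 s) (le_trans _ (NM 0)). Qed.

Let variation_ub k f a : (forall t, 0 <= f t <= io a) -> 0 <= a ->
  variation s (N k) f <= M * a.
Proof.
move=> fa a0; apply: le_trans (variation_bound (N k) fa a0) _.
by rewrite ler_wpM2r// nrm_le normr_id.
Qed.

Section ultralimit.
Variable U : set_system nat.
Hypothesis UU : UltraFilter U.

(** The weak-star limit of the variations of the N k along the ultrafilter U. *)
Definition ulim f : R := lim (variation s (N k) f @[k --> U]).

Lemma ulim_cvg f : (forall t, 0 <= f t) ->
  variation s (N k) f @[k --> U] --> ulim f.
Proof.
move=> f0; have [||a _ ca] := @ultra_cvg_compact _ _ U
    (fun k => variation s (N k) f) `[0, M * nrm s `|f|]%classic UU.
- exact: segment_compact.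
- move=> k; rewrite /= in_itv/=; apply/andP; split; first exact: variation_ge0.
  apply: variation_ub => [t|]; last exact: nrm_ge0.
  by rewrite f0/= nrmE normr_id -[leLHS](ger0_norm (f0 t)) cfun_norm_ub.
- by rewrite /ulim; apply/cvg_ex; exists a.
Qed.

Let ulim_is_cvg f : (forall t, 0 <= f t) ->
  cvg (variation s (N k) f @[k --> U]).
Proof. by move=> f0; apply: cvgP (ulim_cvg f0). Qed.

Lemma ulim_ge0 f : (forall t, 0 <= f t) -> 0 <= ulim f.
Proof.
move=> f0; apply: limr_ge; first exact: ulim_is_cvg.
by apply: nearW => k; exact: variation_ge0.
Qed.

Lemma ulimD f g : (forall t, 0 <= f t) -> (forall t, 0 <= g t) ->
  ulim (f + g) = ulim f + ulim g.
Proof.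
move=> f0 g0; apply: cvg_lim => //.
rewrite (_ : (fun k => _) = fun k => variation s (N k) f + variation s (N k) g).
  by apply: cvgD; exact: ulim_cvg.
by apply/funext => k; exact: variationD.
Qed.

Lemma ulimZ f a : (forall t, 0 <= f t) -> 0 < a -> ulim (io a *: f) = a * ulim f.
Proof.
move=> f0 a0; apply: cvg_lim => //.
rewrite (_ : (fun k => _) = fun k => a * variation s (N k) f).
  by apply: cvgMr; exact: ulim_cvg.
by apply/funext => k; exact: variationZ.
Qed.

Lemma ler_ulim f g : (forall t, 0 <= f t) -> (forall t, f t <= g t) ->
  ulim f <= ulim g.
Proof.
move=> f0 fg; have g0 t : 0 <= g t by exact: le_trans (fg t).
apply: ler_lim; [exact: ulim_is_cvg|exact: ulim_is_cvg|].
by apply: nearW => k; exact: le_variation_fun.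
Qed.

Lemma ulim_lt f a : (forall t, 0 <= f t) -> ulim f < a ->
  U [set k | variation s (N k) f < a].
Proof. by move=> f0; exact: cvgr_lt (ulim_cvg f0) a. Qed.

End ultralimit.

End ultralimits.

(** * The gliding hump *)

Section gliding_hump.
Variables (R : realType) (F : scalarFieldType) (s : real_structure R F).
Variable K : compactHausdorffType.
Hypothesis KS : sigma_stonean K.
Local Notation io := (ofR s).
Local Notation re := (re s).
Local Notation C := (cfun K F).
Implicit Types f g z : C.
Variables (N : nat -> dual C) (M c : R).
Hypothesis NM : forall k, `|N k| <= io M.
Hypothesis Nz : forall n, exists2 z, unit_ball z &
  forall k, (k < n)%N -> c <= re (N k z).

Definition witnesses n : set C :=
  [set z | unit_ball z /\ forall k, (k < n)%N -> c <= re (N k z)].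

Definition far (a : R) z z' : set K := closure [set t | io a < `|(z' - z) t|].

(** [far] is a clopen set lying between the strict and the large level sets. *)
Lemma clopen_far a z z' : clopen (far a z z').
Proof. exact: clopen_closure_gt. Qed.

Lemma far_out a z z' t : ~ far a z z' t -> `|z' t - z t| <= io a.
Proof.
move=> nt; rewrite -[_ - _]/((z' - z) t) -(nrmE s) ler_ofR leNgt; apply/negP => h.
by apply: nt; apply: subset_closure; rewrite /= -(nrmE s) ltr_ofR.
Qed.

Lemma far_in a z z' t : far a z z' t -> io a <= `|z' t - z t|.
Proof.
move=> ft; have /closure_id h := @cfun_closed_ge _ _ s K (z' - z) a.
change ([set t | io a <= `|(z' - z) t|] t); rewrite h.
by apply: closure_subset ft => u /ltW.
Qed.

Lemma ulim_sqn_midpoint (U : set_system nat) (UU : UltraFilter U) x y :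
  ulim s N U (sqn (x - y)) + 4 * ulim s N U (sqn (io 2^-1 *: (x + y))) =
  2 * ulim s N U (sqn x) + 2 * ulim s N U (sqn y).
Proof.
have addE f g : (forall t, 0 <= f t) -> (forall t, 0 <= g t) ->
    ulim s N U (f + g) = ulim s N U f + ulim s N U g.
  by move=> f0 g0; exact: (ulimD NM).
rewrite sqnZ (ulimZ NM)//; last exact: sqn_ge0.
rewrite mulrA (_ : 4 * 2^-1 ^+ 2 = 1) ?mul1r; last by field.
rewrite addrC -addE; [|exact: sqn_ge0|exact: sqn_ge0].
have D0 t : 0 <= (sqn x + sqn y) t.
  by apply: addr_ge0; exact: sqn_ge0.
rewrite (sqn_parallelogram s) mulr2n addE// addE; [|exact: sqn_ge0|exact: sqn_ge0].
by ring.
Qed.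

(** Chebyshev's inequality for the ultralimit functional. *)
Lemma ulim_far (U : set_system nat) (UU : UltraFilter U) a z z' : 0 < a ->
  a ^+ 2 * ulim s N U (indic F (far a z z')) <= ulim s N U (sqn (z' - z)).
Proof.
move=> a0; have a20 : 0 < a ^+ 2 by rewrite exprn_gt0.
rewrite -(ulimZ NM)//; last exact: indic_ge0.
apply: (ler_ulim NM) => t.
  by rewrite cfun_scaleE mulr_ge0 ?indic_ge0// ofR_ge0 ltW.
rewrite cfun_scaleE indicE; last exact: clopen_far.
case: ifPn => [/set_mem/far_in ft|_]; last by rewrite mulr0 exprn_ge0.
by rewrite mulr1 rmorphXn/= lerXn2r ?nnegrE// ofR_ge0 ltW.
Qed.

Lemma witnesses_minimizers (U : set_system nat) (UU : UltraFilter U) : exists d,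
  (forall n e, 0 < e -> exists2 z, witnesses n z & ulim s N U (sqn z) <= d + e) /\
  (forall e, 0 < e -> exists n, forall z z', witnesses n z -> witnesses n z' ->
     ulim s N U (sqn z) <= d + e -> ulim s N U (sqn z') <= d + e ->
     ulim s N U (sqn (z' - z)) <= 8 * e).
Proof.
have [n|m n mn z [z1 zn]|n z [z1 _]|n z z' [z1 zn] [z'1 z'n]|] :=
    @near_minimizers R C witnesses (fun z => ulim s N U (sqn z))
      (fun z z' => ulim s N U (sqn (z' - z))) M.
- by have [z z1 zn] := Nz n; exists z.
- by split=> // k km; apply: zn; exact: leq_trans mn.
- rewrite (ulim_ge0 NM)//=.
  have M0 : 0 <= M by rewrite -(ofR_ge0 s) (le_trans _ (NM 0)).
  apply: limr_le; first exact: cvgP (ulim_cvg NM UU (fun t => sqn_ge0 z t)).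
  apply: nearW => k; have /cfun_unit_ballP z1' := z1.
  apply: le_trans (@variation_bound _ _ s _ (N k) _ 1 _ _) _ => //.
    by move=> t; rewrite rmorph1 sqn_ge0/= exprn_ile1.
  by rewrite mulr1 nrm_le normr_id.
- exists (io 2^-1 *: (z + z')); last first.
    by rewrite [z + z']addrC ulim_sqn_midpoint// addrC.
  have E : io 2^-1 *: (z + z') = io (1 - 2^-1) *: z + io 2^-1 *: z'.
    by rewrite scalerDr; congr (io _ *: z + _); field.
  split=> [|k kn]; first by rewrite E; apply: unit_ball_conv => //; lra.
  rewrite dual_reZ re_dualD.
  by have := zn _ kn; have := z'n _ kn; lra.
- by move=> d dP; exists d.
Qed.

(** Choose the z i as near-minimisers of the ultralimit seminorm among the
    witnesses of ever longer initial segments; consecutive ones are close for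
    this seminorm, so by [ulim_far] the set where they differ by eta i has
    ultralimit mass below eta i, and hence mass below eta i for almost every
    k along the ultrafilter. The next index is picked among those k; only then
    is z i.+1 chosen, as a witness for it. A state of the recursion holds the
    step, the function, the index and the set of indices still allowed. *)
Lemma gliding_hump (eta : nat -> R) : (forall i, 0 < eta i) ->
  exists (z : nat -> C) (k : nat -> nat), [/\
    forall i, unit_ball (z i),
    forall i, (k i < k i.+1)%N,
    forall i, c <= re (N (k i.+1) (z i.+1)) &
    forall i j, (j < i)%N ->
      variation s (N (k i.+1)) (indic F (far (eta j) (z j) (z j.+1))) <= eta j].
Proof.
move=> eta0.
have [U [UU Uoo]] := @ultraFilterLemma nat \oo _.
have [d [minz closez]] := witnesses_minimizers UU.
pose q z := ulim s N U (sqn z).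
(* Tolerances small enough for 8 * delta i < eta i ^ 3: Chebyshev at level eta i
   costs a square, and a mass below eta i is wanted. *)
pose delta := fix delta i :=
  if i is j.+1 then Num.min (delta j) (eta i ^+ 3 / 16) else eta i ^+ 3 / 16.
have deltaE i : delta i.+1 = Num.min (delta i) (eta i.+1 ^+ 3 / 16) by [].
have eta3 i : 0 < eta i ^+ 3 / 16 by rewrite divr_gt0// exprn_gt0.
have delta0 i : 0 < delta i.
  by elim: i => [|i IH]; [exact: eta3|rewrite deltaE lt_min IH eta3].
have delta_le i : delta i.+1 <= delta i by rewrite deltaE ge_min lexx.
have delta_eta i : delta i <= eta i ^+ 3 / 16.
  by case: i => [|i]; [exact: lexx|rewrite deltaE ge_min lexx orbT].
pose n i := sval (cid (closez _ (delta0 i))).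
have nP i z z' : witnesses (n i) z -> witnesses (n i) z' ->
    q z <= d + delta i -> q z' <= d + delta i -> q (z' - z) <= 8 * delta i.
  exact: (svalP (cid (closez _ (delta0 i)))).
pose inv (x : nat * C * nat * set nat) := let: (i, z, k, W) := x in
  [/\ U W, witnesses (n i) z, witnesses k.+1 z & q z <= d + delta i].
pose step (x y : nat * C * nat * set nat) := let: (i, z, k, W) := x in
  let: (i', z', k', W') := y in
  [/\ i' = i.+1, (k < k')%N, W k' &
      W' = W `&` [set k | variation s (N k) (indic F (far (eta i) z z')) < eta i]].
have witS m p z : (m <= p)%N -> witnesses p z -> witnesses m z.
  by move=> mp [z1 zp]; split=> // k km; apply: zp; exact: leq_trans mp.
have stepP (x : {x | inv x}) : {y : {x | inv x} | step (sval x) (sval y)}.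
  apply: cid; case: x => -[[[i z] k] W] /= [UW zn zk qz].
  have UW' : U (W `&` [set k' | (k < k')%N]).
    by apply: filterI => //; apply: Uoo; exists k.+1.
  have [k' [Wk' kk']] := filter_ex UW'.
  (* Large enough to stay close to z, to allow the next step, and to be a
     witness for k'. *)
  pose p := maxn (maxn (n i) (n i.+1)) k'.+1.
  have [z' z'p qz'] := minz p _ (delta0 i.+1).
  pose W' := W `&` [set k | variation s (N k) (indic F (far (eta i) z z')) < eta i].
  have UW'' : U W'.
    apply: filterI => //; apply: (ulim_lt NM) => [t|]; first exact: indic_ge0.
    have e2 : 0 < eta i ^+ 2 by rewrite exprn_gt0.
    rewrite -(ltr_pM2l e2) (le_lt_trans (ulim_far _ _ _ (eta0 i)))//.
    apply: (@le_lt_trans _ _ (8 * delta i)).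
      apply: nP => //; first by apply: witS z'p; rewrite /p !leq_max leqnn.
      by rewrite (le_trans qz')// lerD2l.
    have := delta_eta i; have : 0 < eta i ^+ 3 by rewrite exprn_gt0.
    by rewrite -exprSr; lra.
  have iy : inv (i.+1, z', k', W').
    split=> //; apply: witS z'p; first by rewrite /p !leq_max leqnn orbT.
    by rewrite /p leq_max leqnn orbT.
  by exists (exist _ _ iy).
have [z0 z0p qz0] := minz (maxn (n 0) 1) _ (delta0 0).
have i0 : inv (0, z0, 0, setT).
  split=> //; first exact: filterT.
  - by apply: witS z0p; rewrite leq_max leqnn.
  - by apply: witS z0p; rewrite leq_max leqnn orbT.
have [x [x0 xS]] := dependent_choice stepP (exist _ _ i0).
pose z i := (sval (x i)).1.1.2; pose k i := (sval (x i)).1.2.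
pose W i := (sval (x i)).2.
have ind i : (sval (x i)).1.1.1 = i.
  elim: i => [|i IH]; first by rewrite x0.
  have := xS i; move: IH; rewrite /step.
  by case: (sval (x i)) (sval (x i.+1)) =>
    [[[a b] p] W1] [[[a1 b1] p1] W2] /= -> [->].
have xE i : sval (x i) = (i, z i, k i, W i).
  by have := ind i; rewrite /z /k /W; case: (sval (x i)) => -[[a b] p] V /= ->.
have invP i : inv (i, z i, k i, W i) by rewrite -xE; exact: svalP.
have stP i : step (i, z i, k i, W i) (i.+1, z i.+1, k i.+1, W i.+1).
  by rewrite -!xE; exact: xS.
exists z, k; split=> [i|i|i|i j ji].
- by have [_ []] := invP i.
- by have [] := stP i.
- by have [_ _ [_ zk] _] := invP i.+1; exact: zk.
have WS m : W (j.+1 + m)%N `<=` W j.+1.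
  elim: m => [|m IH]; first by rewrite addn0.
  rewrite addnS; have [_ _ _ ->] := stP (j.+1 + m)%N.
  by move=> t [/IH].
have [_ _ Wk _] := stP i.
move: Wk; rewrite -(subnKC ji) => /WS; have [_ _ _ ->] := stP j.
by rewrite subnKC// => -[_ /ltW].
Qed.

End gliding_hump.

(** * A single continuous witness *)

Section coherent.
Variables (R : realType) (F : scalarFieldType) (s : real_structure R F).
Variable K : compactHausdorffType.
Hypothesis KS : sigma_stonean K.
Local Notation io := (ofR s).
Local Notation re := (re s).
Local Notation C := (cfun K F).
Implicit Types f g z : C.

Lemma clopen_bigcup_ord (D : nat -> set K) n : (forall i, clopen (D i)) ->
  clopen (\bigcup_(j < n) D j).
Proof.
move=> cD; rewrite bigcup_mkord; elim/big_ind: _ => // [|A B cA cB].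
  by split; [exact: open0|exact: closed0].
by split; [apply: openU; [exact: cA.1|exact: cB.1]|
  apply: closedU; [exact: cA.2|exact: cB.2]].
Qed.

Lemma clopenD (A B : set K) : clopen A -> clopen B -> clopen (A `\` B).
Proof.
move=> [oA cA] [oB cB]; rewrite setDE; split.
  by apply: openI => //; rewrite openC.
by apply: closedI => //; rewrite closedC.
Qed.

Lemma bigcup_ordS (D : nat -> set K) n :
  \bigcup_(j < n.+1) D j = \bigcup_(j < n) D j `|` D n.
Proof. by rewrite !bigcup_mkord big_ord_recr. Qed.

Lemma cfun_addE f g t : (f + g) t = f t + g t. Proof. by []. Qed.

Lemma indic_in (A : set K) t : clopen A -> A t -> indic F A t = 1.
Proof. by move=> cA At; rewrite indicE// mem_set. Qed.

Lemma indic_le (A : set K) f t : clopen A -> (forall t, 0 <= f t) ->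
  (A t -> 1 <= f t) -> indic F A t <= f t.
Proof. by move=> cA f0 f1; rewrite indicE//; case: ifPn => // /set_mem. Qed.

Variables (N : nat -> dual C) (M c : R).
Hypothesis NM : forall k, `|N k| <= io M.
Hypothesis Nz : forall n, exists2 z, unit_ball z &
  forall k, (k < n)%N -> c <= re (N k z).

(** Let D i be the set where z i and z i.+1 differ by eta i, and B i what D i
    adds to the union P i of the earlier ones. The function x is z 0 off the
    B i, and z i.+1 on B i for i in the index set given by
    [rosenthal_disjoint]. For such i, x and z i.+1 agree on B i; off
    B i, P i and the closure of the other pieces x is z 0, which is close to
    z i.+1 there. The measure k i.+1 has little mass on P i by the choice of
    k i.+1 and little on the other pieces by disjointness, so it nearly takes
    at x its value at z i.+1. The constant 4 + M counts twice each of these two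
    masses, for a difference of at most 2, and M times the uniform error. *)
Lemma coherent_witness (e : R) : 0 < e ->
  exists2 x : C, unit_ball x &
    forall m, exists2 k, (m <= k)%N & c - (4 + M) * e <= re (N k x).
Proof.
move=> e0; pose eta i : R := e / 2 ^+ i.+1.
have eta0 i : 0 < eta i by rewrite divr_gt0// exprn_gt0.
have eta_sum n : \sum_(i < n) eta i <= e.
  suff -> : \sum_(i < n) eta i = e - e / 2 ^+ n.
    by rewrite gerBl divr_ge0// ltW// exprn_gt0.
  elim: n => [|n IH]; first by rewrite big_ord0 expr0 divr1 subrr.
  rewrite big_ord_recr/= IH /eta exprS; field.
  by rewrite expf_neq0//.
have [z [k [z1 kS cz Nfar]]] := gliding_hump KS NM Nz eta0.
pose D i := far s (eta i) (z i) (z i.+1).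
pose P i := \bigcup_(j < i) D j.
pose B i := D i `\` P i.
have cD i : clopen (D i) by exact: clopen_far.
have cP i : clopen (P i) by exact: clopen_bigcup_ord.
have cB i : clopen (B i) by exact: clopenD.
have dB_lt i j : (i < j)%N -> B i `&` B j = set0.
  by move=> ij; rewrite -subset0 => t [[Dt _] [_ nP]]; apply: nP; exists i.
have dB i j : i <> j -> B i `&` B j = set0.
  move=> /eqP; rewrite neq_ltn => /orP[/dB_lt//|/dB_lt]; by rewrite setIC.
have zP n t : ~ P n t -> `|z n t - z 0 t| <= io (\sum_(i < n) eta i).
  elim: n => [|n IH]; first by rewrite big_ord0 rmorph0 subrr normr0.
  rewrite /P bigcup_ordS => /not_orP[/IH h /far_out h'].
  rewrite big_ord_recr rmorphD/= [leRHS]addrC.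
  by rewrite (le_trans (ler_distD (z n t) _ _))// lerD.
have varP n i : (n <= i)%N ->
    variation s (N (k i.+1)) (indic F (P n)) <= \sum_(j < n) eta j.
  elim: n => [_|n IH ni].
    rewrite big_ord0 (_ : 0 = nrm s `|N (k i.+1)| * 0); last by rewrite mulr0.
    apply: variation_bound => // t; rewrite indic_ge0/= rmorph0 indicE//.
    by rewrite /P bigcup0 ?in_set0.
  rewrite big_ord_recr/=.
  apply: (@le_trans _ _ (variation s (N (k i.+1)) (indic F (P n) + indic F (D n)))).
    apply: le_variation_fun => t; first exact: indic_ge0.
    apply: indic_le => [|t'|]; first exact: cP.
      by rewrite addr_ge0 ?indic_ge0.
    rewrite /P bigcup_ordS => -[Pt|Dt].
      by rewrite cfun_addE (indic_in (cP n) Pt) lerDl indic_ge0.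
    by rewrite cfun_addE (indic_in (cD n) Dt) lerDr indic_ge0.
  rewrite variationD; [|exact: indic_ge0|exact: indic_ge0].
  by rewrite lerD ?IH ?Nfar// ltnW.
pose clB S := closure (\bigcup_(j in S) B j).
have cclB S : clopen (clB S) by exact: clopen_closure_bigcup.
pose V i S := variation s (N (k i.+1)) (indic F (clB S)).
have [||i|e' eI Ve] := @rosenthal_disjoint R V e M _ _ _ e0.
- by move=> i S; apply: variation_ge0 => t; exact: indic_ge0.
- move=> i S T ST; rewrite /V -variationD; [|exact: indic_ge0|exact: indic_ge0].
  have ST0 : clB S `&` clB T = set0.
    apply: closure_disjoint; first exact: (cclB T).1.
    rewrite setIC; apply: closure_disjoint.
      by apply: bigcup_open => j _; exact: (cB j).1.
    rewrite -subset0 => t [[j Tj Bj] [l Sl Bl]].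
    have [jl|/eqP/dB h] := eqVneq j l.
      by have : (S `&` T) l; [split=> //; rewrite -jl|rewrite ST].
    by have : (B j `&` B l) t by []; rewrite h.
  have sS : clB S `<=` clB (S `|` T).
    by apply: closure_subset; apply: bigcup_subset => j Sj; left.
  have sT : clB T `<=` clB (S `|` T).
    by apply: closure_subset; apply: bigcup_subset => j Tj; right.
  apply: le_variation_fun => t; first by rewrite addr_ge0 ?indic_ge0.
  have [St|St] := pselect (clB S t).
    have Tt : ~ clB T t.
      by move=> Tt; have : (clB S `&` clB T) t by []; rewrite ST0.
    rewrite (indic_in (cclB _) (sS _ St)).
    rewrite cfun_addE (indic_in (cclB _) St) (indicE _ _ (cclB T)).
    by rewrite memNset// addr0.
  rewrite cfun_addE (indicE _ _ (cclB S)) memNset// add0r.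
  apply: indic_le => // [t'|/sT Tt]; first exact: indic_ge0.
  by rewrite indic_in.
- have fa t : 0 <= indic F (clB setT) t <= io 1 by rewrite rmorph1 indic_bounds.
  apply: le_trans (variation_bound (N (k i.+1)) fa ler01) _.
  by rewrite mulr1 nrm_le normr_id.
have zle j t : `|z j t| <= 1 by move/cfun_unit_ballP: (z1 j).
have [x [x1 xB xV]] := patch s KS (range e') cB dB (fun j => zle j.+1) (zle 0).
exists x; first exact/cfun_unit_ballP.
have k_ge i : (i <= k i)%N by elim: i => // i IH; exact: leq_ltn_trans (kS i).
move=> m; have [i mi] := injective_unbounded m eI.
set j := e' i in mi; exists (k j.+1).
  by rewrite (leq_trans mi)// (leq_trans (leqnSn j))// k_ge.
pose Q := clB (e' @` [set~ i]).
(* A majorant of the difference between x and z j.+1: 2 on the exceptional sets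
   and e elsewhere. *)
pose f : C := (indic F Q + indic F Q) + (indic F (P j) + indic F (P j)) +
  io e *: cst_cfun K 1.
have fE t : f t = (indic F Q t + indic F Q t) +
  (indic F (P j) t + indic F (P j) t) + io e * 1 by [].
have cQ : clopen Q by exact: cclB.
have ie0 : 0 <= io e by rewrite ofR_ge0 ltW.
have QQ t : 0 <= (indic F Q + indic F Q) t by rewrite addr_ge0 ?indic_ge0.
have PP t : 0 <= (indic F (P j) + indic F (P j)) t by rewrite addr_ge0 ?indic_ge0.
have QP t : 0 <= (indic F Q + indic F Q + (indic F (P j) + indic F (P j))) t.
  by rewrite cfun_addE addr_ge0.
have e1 t : 0 <= (io e *: cst_cfun K 1) t by rewrite cfun_scaleE mulr_ge0//=.
have two t : `|x t - z j.+1 t| <= 1 + 1.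
  by rewrite (le_trans (ler_normB _ _))// lerD.
have domf : dominates f (x - z j.+1).
  move=> t; rewrite [(x - _) t](_ : _ = x t - z j.+1 t)//.
  have [Bt|nBt] := pselect (B j t).
    by rewrite (xB j)// ?subrr ?normr0// cfun_addE addr_ge0.
  have [Qt|nQt] := pselect (Q t).
    rewrite (le_trans (two t))// fE (indic_in cQ Qt) -addrA lerDl.
    by rewrite mulr1 addr_ge0// addr_ge0 ?indic_ge0.
  have [Pt|nPt] := pselect (P j t).
    rewrite (le_trans (two t))// fE (indic_in (cP j) Pt) addrAC lerDr.
    by rewrite mulr1 addr_ge0// addr_ge0 ?indic_ge0.
  have nV : ~ closure (\bigcup_(l in range e') B l) t.
    move=> Vt; have Vt' : (closure (\bigcup_(l in e' @` [set~ i]) B l) `|`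
        closure (B j)) t.
      rewrite -closureU; apply: closure_subset Vt => u [_ [l _ <-] Bu].
      have [li|/eqP li] := eqVneq l i; first by right; rewrite /j -li.
      by left; exists (e' l) => //; exists l.
    by case: Vt' => // ; rewrite -((closure_id _).1 (cB j).2).
  rewrite xV// distrC (le_trans (zP j.+1 t _))//.
    by rewrite /P bigcup_ordS => -[//|Dt]; apply: nBt; split.
  rewrite (@le_trans _ _ (io e)) ?ler_ofR// fE mulr1 lerDr.
  exact: QP.
have f0 t : 0 <= f t by exact: dominates_ge0 domf t.
have fvar : variation s (N (k j.+1)) f =
    variation s (N (k j.+1)) (indic F Q) *+ 2 +
    variation s (N (k j.+1)) (indic F (P j)) *+ 2 +
    e * variation s (N (k j.+1)) (cst_cfun K 1).
  rewrite /f !variationD//; [|exact: indic_ge0..].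
  by rewrite variationZ// => t; rewrite /= ler01.
have VQ := Ve i; rewrite /V -/Q -/j in VQ.
have VP := le_trans (varP _ _ (leqnn j)) (eta_sum j).
have V1 : variation s (N (k j.+1)) (cst_cfun K 1) <= M.
  have fa t : 0 <= cst_cfun K (1 : F) t <= io 1 by rewrite rmorph1/= ler01 lexx.
  apply: le_trans (variation_bound (N (k j.+1)) fa ler01) _.
  by rewrite mulr1 nrm_le normr_id.
have eV1 : e * variation s (N (k j.+1)) (cst_cfun K 1) <= e * M.
  by rewrite ler_wpM2l// ltW.
have := norm_le_variation s (N (k j.+1)) f0 domf.
rewrite fvar re_dualB ler_norml => /andP[h _].
have := cz j; lra.
Qed.

End coherent.

(** * Cluster points and the Grothendieck property *)

Section diameters.
Variable F : scalarFieldType.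
Implicit Types (A : set F) (a : nat -> F).

Lemma le_diam A (M : F) p q : (forall x, A x -> `|x| <= M) -> A p -> A q ->
  `|p - q| <= diam A.
Proof.
move=> AM Ap Aq.
apply: (@le_supremum_nneg F _ (A `*` A) (fun p => `|p.1 - p.2|) _ (M + M) (p, q)) => //.
move=> [x y] [/= Ax Ay]; rewrite (le_trans (ler_normB _ _))// lerD//; exact: AM.
Qed.

Lemma diam_le A (M : F) : 0 <= M -> (forall p q, A p -> A q -> `|p - q| <= M) ->
  diam A <= M.
Proof.
move=> M0 AM; apply: supremum_nneg_le => // -[p q] [/= Ap Aq]; exact: AM.
Qed.

Lemma diam_ge0 A (M : F) : (forall x, A x -> `|x| <= M) -> 0 <= diam A.
Proof.
move=> AM.
apply: (@supremum_nneg_ge0 F _ (A `*` A) (fun p => `|p.1 - p.2|) _ (M + M)) => //.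
move=> [x y] [/= Ax Ay]; rewrite (le_trans (ler_normB _ _))// lerD//; exact: AM.
Qed.

Lemma clust_le a (M : F) : 0 <= M -> (forall n, `|a n| <= M) ->
  forall p, clust a p -> `|p| <= M.
Proof.
move=> M0 aM p ap; rewrite -[p]subr0.
have cB : closed [set x : F^o | `|x - 0| <= M].
  by apply: closed_norm_le; exact: ger0_real.
apply: cB => B pB; apply: ap => //.
by exists 0 => // n _ /=; rewrite subr0.
Qed.

Lemma clust_diam_le a (M : F) : 0 <= M -> (forall n, `|a n| <= M) ->
  diam (clust a) <= M + M.
Proof.
move=> M0 aM; apply: diam_le => [|p q pa qa]; first by rewrite addr_ge0.
by rewrite (le_trans (ler_normB _ _))// lerD// (clust_le M0 aM).
Qed.

Lemma clust_near a p (e : F) : 0 < e -> clust a p ->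
  forall m, exists2 n, (m <= n)%N & `|p - a n| < e.
Proof.
move=> e0 ap m.
have [||x [[n mn <-]]] := ap (a @` [set n | (m <= n)%N]) (ball (p : F^o) e).
- by exists m => // n mn; exists n.
- exact: nbhsx_ballx.
by rewrite -ball_normE/= => h; exists n.
Qed.

Lemma ultra_clust (U : set_system nat) (UU : UltraFilter U) a (n : nat -> nat)
    (p : F) : (forall m, U [set k | (m <= n k)%N]) ->
  (fun k => (a (n k) : F^o)) @ U --> (p : F^o) -> clust a p.
Proof.
move=> Un ap A B [m _ mA] pB.
have UB : U [set k | B (a (n k))] by exact: ap.
have [k [mk Bk]] := filter_ex (filterI (Un m) UB).
by exists (a (n k)); split => //; apply: mA.
Qed.

End diameters.

Section grothendieck_cfun.
Variables (R : realType) (F : scalarFieldType) (s : real_structure R F).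
Variable K : compactHausdorffType.
Hypothesis KS : sigma_stonean K.
Local Notation io := (ofR s).
Local Notation re := (re s).
Local Notation C := (cfun K F).

(** Take indices n k and m k along which phi has limits p and q, and rotate the
    differences by w so that phi of them tends to the positive number
    [|p - q|]. Every initial segment of these functionals is nearly as large at
    some point of the unit ball, by [goldstine]; by
    [coherent_witness] infinitely many are so at one x, and an ultralimit along those indices produces
    the cluster points a and b. *)
Lemma oscillation_witness (nu : nat -> dual C) (M : R) (phi : dual (dual C))
    (p q : F) (e : R) : (forall n, `|nu n| <= io M) -> unit_ball phi ->
  clust (fun n => phi (nu n)) p -> clust (fun n => phi (nu n)) q -> 0 < e ->
  exists (x : C) (a b : F), [/\ unit_ball x, clust (fun n => nu n x) a,
    clust (fun n => nu n x) b & `|p - q| <= `|a - b| + io ((7 + 2 * M) * e)].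
Proof.
move=> nuM phi1 pc qc e0; have ie0 : 0 < io e by rewrite ofR_gt0.
have nP k : {n | (k <= n)%N & `|p - phi (nu n)| < io e}.
  by apply: cid2; exact: clust_near.
have mP k : {n | (k <= n)%N & `|q - phi (nu n)| < io e}.
  by apply: cid2; exact: clust_near.
pose n k := s2val (nP k); pose m k := s2val (mP k).
have nk k : (k <= n k)%N := s2valP (nP k).
have mk k : (k <= m k)%N := s2valP (mP k).
have np k : `|p - phi (nu (n k))| < io e := s2valP' (nP k).
have mq k : `|q - phi (nu (m k))| < io e := s2valP' (mP k).
have [w w1 wpq] := polar (p - q).
pose th k : dual C := w *: (nu (n k) - nu (m k)).
have thM k : `|th k| <= io (2 * M).
  rewrite /th normrZ w1 mul1r (le_trans (ler_normB _ _))//.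
  by rewrite mulr2n mulrDl mul1r rmorphD lerD.
have thE k x : th k x = w * (nu (n k) x - nu (m k) x) by [].
have phithE k : phi (th k) = w * (phi (nu (n k)) - phi (nu (m k))).
  by rewrite /th linearZ linearB.
pose D := nrm s (p - q).
have thz l : exists2 z, unit_ball z &
    forall k, (k < l)%N -> D - 3 * e <= re (th k z).
  have [z z1 zP] := @goldstine _ _ s _ l (fun i => th i) phi e phi1 e0.
  exists z => // k kl; apply: le_trans (zP (Ordinal kl)) => /=.
  rewrite phithE.
  have -> : w * (phi (nu (n k)) - phi (nu (m k))) =
      w * (p - q) - w * (p - phi (nu (n k))) + w * (q - phi (nu (m k))) by ring.
  rewrite reD reB wpq -/(nrm s _) -/D.
  have := norm_re_le s (w * (p - phi (nu (n k)))).
  have := norm_re_le s (w * (q - phi (nu (m k)))).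
  rewrite !nrmM [nrm s w](_ : _ = 1) ?mul1r; last first.
    by apply: (fmorph_inj io); rewrite nrmE w1 rmorph1.
  have : nrm s (p - phi (nu (n k))) < e by rewrite -(ltr_ofR s) nrmE.
  have : nrm s (q - phi (nu (m k))) < e by rewrite -(ltr_ofR s) nrmE.
  by rewrite !ler_norml => ? ? /andP[? ?] /andP[? ?]; lra.
have [x x1 xP] := coherent_witness KS thM thz e0.
pose D' := D - 3 * e - (4 + 2 * M) * e.
have xD l : exists2 k, (l <= k)%N & D' <= nrm s (nu (n k) x - nu (m k) x).
  have [k lk h] := xP l; exists k => //; apply: (le_trans h).
  rewrite thE (le_trans (re_le_nrm _ _))// nrmM [nrm s w](_ : _ = 1) ?mul1r//.
  by apply: (fmorph_inj io); rewrite nrmE w1 rmorph1.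
pose S := [set k | D' <= nrm s (nu (n k) x - nu (m k) x)].
pose G := filter_from [set: nat] (fun l => [set k | (l <= k)%N /\ S k]).
have GF : ProperFilter G.
  apply: filter_from_proper => [|l _]; last first.
    by have [k lk Sk] := xD l; exists k.
  apply: filter_from_filter => [|i j _ _]; first by exists 0.
  exists (maxn i j) => // k [/=]; rewrite geq_max => /andP[ik jk] Sk.
  by split.
have [U [UU GU]] := ultraFilterLemma GF.
have US : U S by apply: GU; exists 0 => // k [].
have Ul l : U [set k | (l <= k)%N] by apply: GU; exists l => // k [].
have M0 : 0 <= M by rewrite -(ofR_ge0 s) (le_trans _ (nuM 0)).
have nux l : `|nu l x| <= io M by rewrite (le_trans (dual_le_unit _ x1)).
have [a _ Ua] := @ultra_cvg_compact _ _ U (fun k => nu (n k) x : F^o) _ UU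
  (@compact_closed_ball0 _ _ s (io M)) (fun k => nux (n k)).
have [b _ Ub] := @ultra_cvg_compact _ _ U (fun k => nu (m k) x : F^o) _ UU
  (@compact_closed_ball0 _ _ s (io M)) (fun k => nux (m k)).
exists x, a, b; split=> //.
- apply: (ultra_clust UU _ Ua) => l.
  by apply: filterS (Ul l) => k /= /leq_trans; apply; exact: nk.
- apply: (ultra_clust UU _ Ub) => l.
  by apply: filterS (Ul l) => k /= /leq_trans; apply; exact: mk.
rewrite -!(nrmE s) -rmorphD ler_ofR -/D; apply/ler_addgt0Pr => d d0.
have id0 : 0 < io (d / 2) by rewrite ofR_gt0 divr_gt0.
have Ua' : U [set k | `|a - nu (n k) x| < io (d / 2)].
  have Ua0 : U [set k | ball (a : F^o) (io (d / 2)) (nu (n k) x)].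
    by apply: Ua; exact: nbhsx_ballx.
  by apply: filterS Ua0 => k; rewrite /= -ball_normE.
have Ub' : U [set k | `|b - nu (m k) x| < io (d / 2)].
  have Ub0 : U [set k | ball (b : F^o) (io (d / 2)) (nu (m k) x)].
    by apply: Ub; exact: nbhsx_ballx.
  by apply: filterS Ub0 => k; rewrite /= -ball_normE.
have [k [Sk [/= ak bk]]] := filter_ex (filterI US (filterI Ua' Ub')).
have : nrm s (nu (n k) x - nu (m k) x) <= nrm s (a - b) + (d / 2 + d / 2).
  have -> : nu (n k) x - nu (m k) x =
      (a - b) + ((b - nu (m k) x) - (a - nu (n k) x)) by ring.
  apply: (le_trans (nrmD _ _ _)); rewrite lerD2l.
  apply: (le_trans (nrmB _ _ _)); rewrite addrC.
  by apply: lerD; rewrite nrm_le ltW.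
move: Sk; rewrite /S/= /D' => ? ?; lra.
Qed.

Theorem sigma_stonean_grothendieck : grothendieck (cfun K F) 1.
Proof.
move=> nu /pinfty_ex_gt0[_ /(gt0_ofR s)[M M0 ->] /(_ _ I) /= nuM].
have {}nuM n : `|nu n| <= io M by exact: nuM.
have iM0 : 0 <= io M by rewrite ofR_ge0 ltW.
have nux x l : unit_ball x -> `|nu l x| <= io M.
  by move=> x1; rewrite (le_trans (dual_le_unit _ x1)).
have nu2 (phi : dual (dual C)) l : unit_ball phi -> `|phi (nu l)| <= io M.
  by move=> phi1; rewrite (le_trans (bidual_le_unit _ phi1)).
pose h (x : C) := diam (clust (fun n => nu n x)).
have h0 x : unit_ball x -> 0 <= h x.
  by move=> x1; exact: diam_ge0 (clust_le iM0 (fun l => nux x l x1)).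
have hM x : unit_ball x -> h x <= io M + io M.
  by move=> x1; exact: clust_diam_le iM0 (fun l => nux x l x1).
have star0 : 0 <= delta_weak_star nu.
  exact: (supremum_nneg_ge0 h0 hM).
rewrite mul1r; apply: supremum_nneg_le => // phi phi1.
  exact: diam_ge0 (clust_le iM0 (fun l => nu2 phi l phi1)).
apply: diam_le => // p q pc qc; apply/ler_addgt0Pr => _ /(gt0_ofR s)[d d0 ->].
have c0 : 0 < 7 + 2 * M by lra.
have e0 : 0 < d / (7 + 2 * M) by rewrite divr_gt0.
have [x [a [b [x1 ac bc]]]] := oscillation_witness nuM phi1 pc qc e0.
rewrite mulrCA divff ?lt0r_neq0// mulr1 => /le_trans; apply.
rewrite lerD2r (@le_trans _ _ (h x))//.
  exact: le_diam (clust_le iM0 (fun l => nux x l x1)) ac bc.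
exact: (le_supremum_nneg h0 hM x1).
Qed.

End grothendieck_cfun.

Theorem corollary1p4 (R : realType) (K : compactHausdorffType) :
  (sigma_stonean K ->
     grothendieck (cfun K R) 1 /\ grothendieck (cfun K R[i]) 1) /\
  (extremally_disconnected K ->
     grothendieck (cfun K R) 1 /\ grothendieck (cfun K R[i]) 1).
Proof.
suff SG : sigma_stonean K ->
    grothendieck (cfun K R) 1 /\ grothendieck (cfun K R[i]) 1.
  by split=> // KE; apply: SG => U oU _; exact: KE.
move=> KS; split.
  exact: sigma_stonean_grothendieck (real_real_structure R) K KS.
exact: sigma_stonean_grothendieck (complex_real_structure R) K KS.
Qed.
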